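(* Let $\mathcal{X}$ be a countable domain and $\mathcal{H}\subseteq\{0,1\}^{\mathcal{X}}$ a concept class. Then $\mathcal{H}$ is pure differentially private PAC learnable if and only if its fractional clique dimension $\mathtt{CD}^\star(\mathcal{H})$ is finite.
   Context: Datasets, consistency, $\mathcal{H}$-realizability, and the contradiction graph: a dataset of size $m$ is $S=((x_1,y_1),\dots,(x_m,y_m))\in(\mathcal{X}\times\{0,1\})^m$; $h$ is consistent with $S$ if $h(x_i)=y_i$ for all $i$; $S$ is $\mathcal{H}$-realizable if some $h\in\mathcal{H}$ is consistent with it; $G_m(\mathcal{H})$ has as vertices the $\mathcal{H}$-realizable datasets of size $m$, with $S,S'$ adjacent iff there is $x$ with $(x,0)$ appearing in $S$ and $(x,1)$ appearing in $S'$. A fractional clique of a graph $G=(V,E)$ is $\delta:V\to[0,\infty)$ with $\sum_{v\in I}\delta(v)\le1$ for every independent set $I$; its size is $\sum_v\delta(v)$; $\omega^\star_m$ is the supremum of sizes of fractional cliques of $G_m(\mathcal{H})$. The fractional clique dimension is $\mathtt{CD}^\star(\mathcal{H})=\sup\{m:\omega^\star_m=2^m\}\in\mathbb{N}\cup\{\infty\}$. PAC learning: for a distribution $\mathcal{D}$ on $\mathcal{X}\times\{0,1\}$, $L_{\mathcal{D}}(h)=\Pr_{(x,y)\sim\mathcal{D}}[h(x)\ne y]$; $\mathcal{D}$ is realizable if $\inf_{h\in\mathcal{H}}L_{\mathcal{D}}(h)=0$. A (possibly randomized) algorithm $\mathcal{A}$ mapping datasets to hypotheses is an $(m,\alpha,\beta)$-learner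 if for every realizable $\mathcal{D}$, $\Pr_{S\sim\mathcal{D}^m}[L_{\mathcal{D}}(\mathcal{A}(S))>\alpha]<\beta$. $\mathcal{A}$ is $(\epsilon,\delta)$-differentially private if for all datasets $S,S'$ of the same size differing in a single example and every event $E$, $\Pr[\mathcal{A}(S)\in E]\le e^{\epsilon}\Pr[\mathcal{A}(S')\in E]+\delta$. $\mathcal{H}$ is pure DP PAC learnable if there are $\alpha(m),\beta(m)\to0$ and an algorithm that for every $m$ is an $(m,\alpha(m),\beta(m))$-learner and is $(\epsilon,0)$-differentially private for a numerical constant $\epsilon=O(1)$. *)

(* Defs.v *)
From HB Require Import structures.
From mathcomp Require Import all_boot all_order all_algebra.
From mathcomp Require Import all_classical all_reals all_analysis.
Unset Implicit Arguments.
Import Order.TTheory GRing.Theory Num.Theory numFieldNormedType.Exports.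
Local Open Scope classical_set_scope.
Local Open Scope ring_scope.

Definition dataset (X : countType) (m : nat) := m.-tuple (X * bool).

Definition consistent (X : countType) (m : nat) (h : X -> bool) (S : dataset X m) :=
  forall z, z \in (S : seq (X * bool)) -> h z.1 = z.2.

Definition realizable_data (X : countType) (H : set (X -> bool)) (m : nat)
  (S : dataset X m) := exists2 h, H h & consistent X m h S.

Definition Gvert (X : countType) (H : set (X -> bool)) (m : nat) : set (dataset X m) :=
  [set S | realizable_data X H m S].

Definition contra (X : countType) (m : nat) (S S' : dataset X m) :=
  exists x, (x, false) \in (S : seq (X * bool)) /\ (x, true) \in (S' : seq (X * bool)).

Definition Gadj (X : countType) (m : nat) (S S' : dataset X m) :=
  contra X m S S' \/ contra X m S' S.

Definition Gindep (X : countType) (H : set (X -> bool)) (m : nat) (I : set (dataset X m)) :=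
  I `<=` Gvert X H m /\ forall S S', I S -> I S' -> ~ Gadj X m S S'.

(* fractional clique of G_m(H): delta : V -> [0,oo) with sum over every
   independent set <= 1 (values of delta outside V are irrelevant). *)
Definition frac_clique (R : realType) (X : countType) (H : set (X -> bool)) (m : nat)
  (delta : dataset X m -> R) :=
  (forall S, Gvert X H m S -> 0 <= delta S) /\
  forall I, Gindep X H m I -> (\esum_(S in I) (delta S)%:E <= 1)%E.

Definition frac_clique_size (R : realType) (X : countType) (H : set (X -> bool)) (m : nat)
  (delta : dataset X m -> R) : \bar R :=
  \esum_(S in Gvert X H m) (delta S)%:E.

Definition frac_clique_number (R : realType) (X : countType) (H : set (X -> bool)) (m : nat)
  : \bar R :=
  ereal_sup [set frac_clique_size R X H m delta
            | delta in [set d | frac_clique R X H m d]].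

(* CD*(H) = sup {m | omega*_m = 2^m} is finite, i.e. that set is bounded in N *)
Definition CDstar_finite (R : realType) (X : countType) (H : set (X -> bool)) :=
  exists N : nat, forall m : nat,
    frac_clique_number R X H m = ((2 ^ m)%:R)%:E -> (m <= N)%N.

(* A distribution D on X * {0,1}; X is countable, so D is given by a pmf. *)
Definition is_pmf (R : realType) (X : countType) (p : X * bool -> R) :=
  (forall z, 0 <= p z) /\ (\esum_(z in [set: X * bool]) (p z)%:E = 1)%E.

Definition loss (R : realType) (X : countType) (p : X * bool -> R) (h : X -> bool) : \bar R :=
  \esum_(z in [set z : X * bool | h z.1 != z.2]) (p z)%:E.

Definition realizable_dist (R : realType) (X : countType) (H : set (X -> bool))
  (p : X * bool -> R) :=
  ereal_inf [set loss R X p h | h in H] = 0%E.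

(* Output hypotheses h : X -> {0,1}, with the product sigma-algebra generated
   by the evaluation maps h |-> h x. *)
Definition hyp_gen (X : countType) : set (set (X -> bool)) :=
  [set A | exists (x : X) (b : bool), A = [set h | h x = b]].

Definition hypT (X : countType) := g_sigma_algebraType (hyp_gen X).

(* A (possibly randomized) algorithm: for each sample size m and dataset of
   size m, a probability distribution of its output hypothesis. *)
Definition algorithm (R : realType) (X : countType) :=
  forall m : nat, dataset X m -> probability (hypT X) R.

Definition sample_prob (R : realType) (X : countType) (p : X * bool -> R) (m : nat)
  (S : dataset X m) : R := \prod_(z <- (S : seq (X * bool))) p z.

Definition fail_prob (R : realType) (X : countType) (A : algorithm R X)
  (p : X * bool -> R) (m : nat) (alpha : R) : \bar R :=
  \esum_(S in [set: dataset X m])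
     ((sample_prob R X p m S)%:E * A m S [set h : hypT X | (alpha%:E < loss R X p h)%E])%E.

Definition learner (R : realType) (X : countType) (H : set (X -> bool))
  (A : algorithm R X) (m : nat) (alpha beta : R) :=
  forall p : X * bool -> R, is_pmf R X p -> realizable_dist R X H p ->
    (fail_prob R X A p m alpha < beta%:E)%E.

Definition neighbors (X : countType) (m : nat) (S S' : dataset X m) :=
  exists i : 'I_m, forall j : 'I_m, j != i -> tnth S j = tnth S' j.

Definition pure_dp (R : realType) (X : countType) (A : algorithm R X) (eps : R) (m : nat) :=
  forall S S' : dataset X m, neighbors X m S S' ->
    forall E : set (hypT X), measurable E ->
      (A m S E <= (expR eps)%:E * A m S' E)%E.

Definition pure_dp_pac_learnable (R : realType) (X : countType) (H : set (X -> bool)) :=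
  exists (A : algorithm R X) (alpha beta : nat -> R) (eps : R),
    [/\ 0 < eps,
        alpha n @[n --> \oo] --> (0 : R),
        beta n @[n --> \oo] --> (0 : R),
        (forall m, learner R X H A m (alpha m) (beta m)) &
        (forall m, pure_dp R X A eps m)].

(* Main.v *)
Require Import Defs.
From HB Require Import structures.
From mathcomp Require Import all_boot all_order all_algebra.
From mathcomp Require Import all_classical all_reals all_analysis.
From mathcomp Require Import measurable_realfun ring lra zify.

(** A distribution [mu] on hypotheses "represents" [H] at accuracy [eps] if, for
    some [c > 0], every realizable dataset has empirical error at most [eps] with
    [mu]-probability at least [c]; both properties of the theorem are equivalent to
    the existence of such [mu] for all [eps].

    From a private learner, group privacy makes the output distribution on any fixed
    dataset a representation at accuracy [1/8]. Flipping each label of such a random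
    hypothesis independently with probability [1/4] makes it consistent with any given
    realizable dataset of size [n] with probability at least
    [c * 2^-n * (3/2)^(n/2)], and weak duality bounds the fractional clique number by
    the inverse of this, which is below [2^n] for large [n].

    Conversely, if [omega*_m < 2^m], then on every finite subdomain a minimax argument
    (multiplicative weights) gives a distribution of hypotheses under which every
    realizable dataset of size [m] is fitted with probability at least [v > 2^-m].
    Since the average of [(1 - L_p)^m] is then at least [v], a random hypothesis is a
    weak learner with probability bounded below, and the majority vote of independent
    copies follows the boosting path with probability bounded below. As the constants
    do not depend on the subdomain, an ultrafilter limit of these distributions
    gives a representation on the whole domain, and the exponential mechanism with
    this base measure is a private learner. *)

Set Implicit Arguments.
Unset Strict Implicit.
Unset Printing Implicit Defensive.
Import Order.TTheory GRing.Theory Num.Theory numFieldNormedType.Exports.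
Local Open Scope classical_set_scope.
Local Open Scope ring_scope.

(** * Minimax by multiplicative weights *)

Lemma bernoulli_ge (R : realFieldType) (x : R) n :
  -1 <= x -> 1 + n%:R * x <= (1 + x) ^+ n.
Proof.
move=> x1; elim: n => [|n IH]; first by rewrite mul0r addr0 expr0.
have : (1 + x) * (1 + n%:R * x) <= (1 + x) ^+ n.+1.
  by rewrite exprS ler_wpM2l //; lra.
apply: le_trans; rewrite -natr1.
have : 0 <= n%:R * (x * x) by rewrite mulr_ge0 // -expr2 sqr_ge0.
by lra.
Qed.

(** By Bernoulli, the ratio [(x / y) ^+ k] grows at least linearly in [k]. *)
Lemma exists_expr_gap (R : archiRealFieldType) (x y C : R) :
  0 < y -> y < x -> exists2 k, (0 < k)%N & C * y ^+ k < x ^+ k.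
Proof.
move=> y0 yx; pose s := x / y - 1.
have s0 : 0 < s by rewrite subr_gt0 ltr_pdivlMr // mul1r.
exists (Num.bound `|C / s|).+1 => //; set k := _.+1.
have Cs : C < k%:R * s.
  rewrite -ltr_pdivrMr //; apply: le_lt_trans (ler_norm _) _.
  by apply: lt_trans (archi_boundP (normr_ge0 _)) _; rewrite ltr_nat.
have -> : x ^+ k = (1 + s) ^+ k * y ^+ k.
  by rewrite -exprMn /s addrC subrK divfK // gt_eqF.
rewrite ltr_pM2r ?exprn_gt0 //.
have := @bernoulli_ge _ s k; lra.
Qed.

Section Minimax.
Variables (R : archiRealFieldType) (I J : finType) (P : pred I).
Variables (A : I -> J -> bool) (v : R).

Hypothesis best_response : forall w : I -> R, (forall i, 0 <= w i) ->
  exists j, v * \sum_(i | P i) w i <= \sum_(i | P i && A i j) w i.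

(** Each round plays a best response to the current weights and scales the rows it hits by [1 - q].
    These carry at least a share [v] of the total, which therefore shrinks by a factor
    [1 - q * v]. *)
Lemma multiplicative_weights (q : R) T : 0 <= q -> q <= 1 -> q * v <= 1 ->
  exists2 s : seq J, size s = T &
    \sum_(i | P i) (1 - q) ^+ count (A i) s <= (1 - q * v) ^+ T * #|P|%:R.
Proof.
move=> q0 q1 qv; elim: T => [|T [s szs IH]].
  by exists [::] => //=; rewrite expr0 mul1r sumr_const.
pose w i := (1 - q) ^+ count (A i) s.
have w0 i : 0 <= w i by rewrite exprn_ge0 // subr_ge0.
have [j hj] := best_response w0.
exists (j :: s); first by rewrite /= szs.
have -> : \sum_(i | P i) (1 - q) ^+ count (A i) (j :: s) =
          \sum_(i | P i) w i - q * \sum_(i | P i && A i j) w i.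
  rewrite big_mkcondr mulr_sumr -sumrB; apply: eq_bigr => i _ /=.
  by case: (A i j); rewrite /w ?add1n ?add0n ?exprS; ring.
apply: (@le_trans _ _ ((1 - q * v) * \sum_(i | P i) w i)).
  by have := ler_wpM2l q0 hj; lra.
by rewrite exprS -mulrA ler_wpM2l // subr_ge0.
Qed.

(** [nu] is the empirical distribution of [b * k] plays. A row hit fewer than [a * k] times would
    keep weight at least [x ^+ k], while the total is at most [#|P| * y ^+ k], which is smaller for
    large [k]. A rational target [a / b] keeps all exponents integral. *)
Lemma approximate_minimax (a b : nat) :
  v <= 1 -> (0 < b)%N -> a%:R < v * b%:R ->
  exists nu : J -> R, [/\ forall j, 0 <= nu j, \sum_j nu j = 1 &
    forall i, P i -> a%:R / b%:R <= \sum_(j | A i j) nu j].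
Proof.
move=> v1 b0 avb.
have bR : 0 < b%:R :> R by rewrite ltr0n.
have a0 : 0 <= a%:R :> R by rewrite ler0n.
pose u := v * b%:R; have u0 : 0 < u by apply: le_lt_trans avb.
have a1 : 0 < a%:R + 1 :> R by lra.
(* Chosen so that [q * u * a < u - a], which is what [(1 - q * a) * (1 + q * u) > 1], hence [y < x],
   amounts to. *)
pose q := (u - a%:R) / (u * (a%:R + 1)).
have q0 : 0 < q by apply: divr_gt0; [rewrite subr_gt0|exact: mulr_gt0].
have v0 : 0 < v by rewrite -(pmulr_lgt0 _ bR).
have qa1 : q * (a%:R + 1) <= 1.
  have -> : q * (a%:R + 1) = (u - a%:R) / u by rewrite /q; field; rewrite ?gt_eqF.
  by rewrite ler_pdivrMr //; lra.
have q1 : q <= 1 by have := mulr_ge0 (ltW q0) a0; lra.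
have qv : q * v <= 1 by rewrite mulr_ile1 // ltW.
have key : q * u * a%:R < u - a%:R.
  have -> : q * u * a%:R = (u - a%:R) * (a%:R / (a%:R + 1)).
    by rewrite /q; field; rewrite ?gt_eqF.
  rewrite -[ltRHS]mulr1 ltr_pM2l ?subr_gt0 //.
  by rewrite ltr_pdivrMr //; lra.
pose x : R := (1 - q) ^+ a; pose y := (1 + q * u)^-1.
have qu0 : 0 < q * u by rewrite mulr_gt0.
have y0 : 0 < y by rewrite invr_gt0; lra.
have xge : 1 - q * a%:R <= x.
  by have := @bernoulli_ge _ (- q) a; rewrite -/x; lra.
have yx : y < x.
  apply: lt_le_trans xge; rewrite /y -[ltLHS]mul1r ltr_pdivrMr; last by lra.
  have : q * (q * u * a%:R) < q * (u - a%:R) by rewrite ltr_pM2l.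
  by lra.
have yge : (1 - q * v) ^+ b <= y.
  rewrite /y -[leRHS]mul1r ler_pdivlMr; last by lra.
  have h1 : 1 + q * u <= (1 + q * v) ^+ b.
    apply: le_trans (bernoulli_ge _ _); last by have := mulr_gt0 q0 v0; lra.
    by rewrite /u; lra.
  apply: le_trans (ler_wpM2l _ h1) _; first by rewrite exprn_ge0 // subr_ge0.
  rewrite -exprMn exprn_ile1 //.
    by rewrite mulr_ge0 //; have := mulr_gt0 q0 v0; lra.
  have := sqr_ge0 (q * v); rewrite expr2; lra.
have [k k0 hk] := exists_expr_gap #|P|%:R y0 yx.
have [s szs hs] := @multiplicative_weights q (b * k) (ltW q0) q1 qv.
have bk0 : 0 < (b * k)%:R :> R by rewrite ltr0n muln_gt0 b0.
have cnt (Q : pred J) : \sum_(j | Q j) (count_mem j s)%:R = (count Q s)%:R :> R.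
  rewrite -natr_sum; congr (_%:R); elim: (s) => [|j t IH] /=.
    by rewrite big1.
  rewrite big_split /= IH; congr (_ + _)%N.
  rewrite big_mkcond (bigD1 j) //= eqxx big1 ?addn0; first by case: (Q j).
  by move=> i /negPf; rewrite eq_sym => ->; rewrite if_same.
exists (fun j => (count_mem j s)%:R / (b * k)%:R); split.
- by move=> j; rewrite divr_ge0.
- by rewrite -mulr_suml cnt count_predT szs divff // gt_eqF.
move=> i Pi; rewrite -mulr_suml cnt.
rewrite ler_pdivlMr // natrM mulrA divfK ?gt_eqF // -natrM ler_nat.
rewrite leqNgt; apply/negP => lt.
have : (1 - q) ^+ count (A i) s <= #|P|%:R * y ^+ k.
  apply: le_trans (le_trans _ hs) _.
    rewrite (bigD1 i) //= lerDl sumr_ge0 // => l _.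
    by rewrite exprn_ge0 // subr_ge0.
  rewrite mulrC ler_wpM2l // exprM lerXn2r // ?nnegrE.
    by rewrite exprn_ge0 // subr_ge0.
  exact: ltW.
apply/negP; rewrite -ltNge; apply: lt_le_trans hk _.
rewrite /x -exprM; apply: ler_wiXn2l => //; last exact: ltnW.
  by rewrite subr_ge0.
by rewrite gerBl ltW.
Qed.

End Minimax.

(** * Weak learning and boosting on a finite domain *)

Definition fits (T : finType) (m : nat) (g : {ffun T -> bool})
  (f : {ffun 'I_m -> T * bool}) := [forall i, g (f i).1 == (f i).2].

Section WeakLearner.
Variables (R : realFieldType) (T : finType) (m : nat).
Variables (rz : pred {ffun 'I_m -> T * bool}) (nu : {ffun T -> bool} -> R).
Variables (v theta c : R).
Hypotheses (nu0 : forall g, 0 <= nu g) (nu1 : \sum_g nu g = 1).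
Hypothesis nu_fits : forall f, rz f -> v <= \sum_(g | fits g f) nu g.

Definition charges_rz (p : T * bool -> R) :=
  forall f : {ffun 'I_m -> T * bool}, (forall i, 0 < p (f i)) -> rz f.

(** The right side is the probability that a random [g] fits [m] independent examples from [p].
    Drawing the examples first, every sample of positive probability satisfies [rz] and is fitted
    with probability at least [v]. *)
Lemma expected_accuracy_pow (p : T * bool -> R) :
  (forall z, 0 <= p z) -> \sum_z p z = 1 -> charges_rz p ->
  v <= \sum_g nu g * (\sum_(z | g z.1 == z.2) p z) ^+ m.
Proof.
move=> p0 p1 prz.
have powE (F : T * bool -> R) : (\sum_z F z) ^+ m =
    \sum_(f : {ffun 'I_m -> T * bool}) \prod_i F (f i).
  rewrite -[X in _ ^+ X](card_ord m) -prodr_const.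
  rewrite -(bigA_distr_bigA (fun (i : 'I_m) z => F z)).
  by apply: eq_bigl => i; rewrite inE.
have -> : \sum_g nu g * (\sum_(z | g z.1 == z.2) p z) ^+ m =
    \sum_(f : {ffun 'I_m -> T * bool}) (\prod_i p (f i)) * \sum_(g | fits g f) nu g.
  under eq_bigr do rewrite big_mkcond powE mulr_sumr.
  rewrite exchange_big; apply: eq_bigr => f _ /=.
  rewrite [X in _ = _ * X]big_mkcond mulr_sumr; apply: eq_bigr => g _.
  case: ifP => [/forallP gf|].
    by rewrite [RHS]mulrC; congr (_ * _); apply: eq_bigr => i _; rewrite gf.
  move=> /negbT /forallPn[i /negPf gi].
  by rewrite (bigD1 i) //= gi mul0r !mulr0.
have tot := powE p; rewrite p1 expr1n in tot.
rewrite -[leLHS]mul1r {1}tot mulr_suml ler_sum // => f _.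
have pf0 : 0 <= \prod_i p (f i) by rewrite prodr_ge0.
have [->|pfn0] := eqVneq (\prod_i p (f i)) 0; first by rewrite !mul0r.
rewrite ler_wpM2l // nu_fits // prz // => i.
rewrite lt0r p0 andbT; apply: contra_neq pfn0 => pi0.
by rewrite (bigD1 i) //= pi0 mul0r.
Qed.

(** Hypotheses of accuracy below [theta] contribute at most [theta ^+ m] to the expected power, so
    the others have mass at least [c]. The weight [p] is left unnormalized because boosting rescales
    it; the minimum with 1 covers total weight zero. *)
Lemma weak_learner (p : T * bool -> R) : theta ^+ m + c <= v -> 0 <= theta ->
  (forall z, 0 <= p z) -> charges_rz p ->
  Num.min c 1 <= \sum_(g : {ffun T -> bool}
      | theta * \sum_z p z <= \sum_(z | g z.1 == z.2) p z) nu g.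
Proof.
move=> thc th0 p0 prz; set s := \sum_z p z.
have s0 : 0 <= s by apply: sumr_ge0.
have [sE|sn0] := eqVneq s 0.
  rewrite (eq_bigl predT) ?nu1 ?ge_min ?lexx ?orbT // => g /=.
  by rewrite sE mulr0 sumr_ge0.
have s_gt0 : 0 < s by rewrite lt0r sn0.
have := @expected_accuracy_pow (fun z => p z / s).
rewrite -mulr_suml divff // => /(_ (fun z => divr_ge0 (p0 z) s0) erefl).
have prz' : charges_rz (fun z => p z / s).
  by move=> f hf; apply: prz => i; have := hf i; rewrite pmulr_lgt0 ?invr_gt0.
move=> /(_ prz') hv.
rewrite ge_min; apply/orP; left.
have : v <= \sum_(g : {ffun T -> bool}
    | theta * s <= \sum_(z | g z.1 == z.2) p z) nu g + theta ^+ m.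
  apply: le_trans hv _.
  have thE : theta ^+ m = \sum_g theta ^+ m * nu g by rewrite -mulr_sumr nu1 mulr1.
  rewrite [X in _ <= _ + X]thE [X in _ <= X + _]big_mkcond -big_split /=.
  apply: ler_sum => g _; rewrite -mulr_suml; set a := \sum_(z | _) _.
  have a0 : 0 <= a / s by rewrite divr_ge0 // sumr_ge0.
  case: ifP => [_|/negbT]; last first.
    rewrite -ltNge => h; rewrite add0r mulrC ler_wpM2r // lerXn2r // ?nnegrE //.
    by rewrite ler_pdivrMr // ltW.
  rewrite -[leLHS]addr0 lerD // ?mulr_ge0 ?exprn_ge0 //.
  rewrite -[leRHS]mulr1 ler_wpM2l // exprn_ile1 // ler_pdivrMr // mul1r.
  by rewrite /a /s big_mkcond ler_sum // => z _; case: ifP.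
by move: thc; lra.
Qed.

End WeakLearner.

(** * Boosting by independent draws from a fixed distribution *)

Section Boosting.
Variables (R : realType) (T : finType).
Local Notation G := {ffun T -> bool}.
Variables (nu : G -> R) (good : (T * bool -> R) -> Prop) (theta c : R).
Hypotheses (nu0 : forall g, 0 <= nu g) (nu1 : \sum_g nu g = 1).
Hypotheses (c0 : 0 <= c) (th2 : 1 / 2 < theta) (th1 : theta <= 1).
Hypothesis good_reweigh : forall p r : T * bool -> R,
  good p -> (forall z, 0 < r z) -> good (fun z => p z * r z).
Hypothesis weak : forall p : T * bool -> R, (forall z, 0 <= p z) -> good p ->
  c <= \sum_(g : {ffun T -> bool} | theta * \sum_z p z <= \sum_(z | g z.1 == z.2) p z) nu g.

(** Probability of an event under [n] independent draws from [nu]; the recursive form lets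
    inductions condition on the first draw. *)
Fixpoint iid_prob (n : nat) (E : seq G -> bool) : R :=
  if n is k.+1 then \sum_g nu g * iid_prob k (fun s => E (g :: s))
  else (E [::])%:R.

Lemma iid_prob_ge0 n E : 0 <= iid_prob n E.
Proof. by elim: n E => [|n IH] E //=; apply: sumr_ge0 => g _; rewrite mulr_ge0. Qed.

Lemma le_iid_prob n (E F : seq G -> bool) : (forall s, E s -> F s) ->
  iid_prob n E <= iid_prob n F.
Proof.
elim: n E F => [|n IH] E F EF /=.
  by rewrite ler_nat; have := EF [::]; do 2 case: (_ [::]) => //; move=> /(_ isT).
by apply: ler_sum => g _; rewrite ler_wpM2l // IH // => s; apply: EF.
Qed.

Lemma iid_prob_pushforward n (M : seq G -> G) (Q : pred G) :
  \sum_(k | Q k) iid_prob n (fun s => M s == k) = iid_prob n (fun s => Q (M s)).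
Proof.
elim: n M => [|n IH] M /=.
  rewrite big_mkcond (bigD1 (M [::])) //= eqxx big1 ?addr0; first by case: ifP.
  by move=> k /negPf; rewrite eq_sym => ->; rewrite if_same.
rewrite exchange_big; apply: eq_bigr => g _ /=.
by rewrite -mulr_sumr (IH (fun s => M (g :: s))).
Qed.

Lemma iid_probT n : iid_prob n (fun=> true) = 1.
Proof. by elim: n => [//|n IH] /=; under eq_bigr do rewrite IH mulr1. Qed.

(** Update factor in the style of AdaBoost: correctly labelled points are divided by it, mislabelled
    ones multiplied. The resulting rate [2 * theta * (1 - theta) + 1 / 2] is below 1 as soon as
    [theta > 1 / 2]. *)
Definition boost_base : R := 2 * theta.
Definition boost_factor (g : G) (z : T * bool) : R :=
  if g z.1 == z.2 then boost_base^-1 else boost_base.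
Definition boost_weight (s : seq G) (z : T * bool) : R :=
  \prod_(g <- s) boost_factor g z.
Definition boost_rate : R := (1 - theta) * boost_base + theta / boost_base.
(** The weight of a labelled point is [boost_base] to the power of votes against minus votes for its
    label, so this comparison is the majority vote, with ties going to [true]. *)
Definition majority (s : seq G) : G :=
  [ffun x => boost_weight s (x, true) <= boost_weight s (x, false)].

Lemma boost_base_gt1 : 1 < boost_base. Proof. by move: th2; rewrite /boost_base; lra. Qed.

Lemma boost_factor_gt0 g z : 0 < boost_factor g z.
Proof.
by have b1 := boost_base_gt1; rewrite /boost_factor; case: ifP; rewrite ?invr_gt0; lra.
Qed.

Lemma boost_rate_lt1 : boost_rate < 1.
Proof.
move: th1 th2 => t1 t2; rewrite /boost_rate /boost_base.
have -> : theta / (2 * theta) = 1 / 2 by field; rewrite gt_eqF //; lra.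
nra.
Qed.

Lemma boost_rate_ge0 : 0 <= boost_rate.
Proof.
move: th1 th2 => t1 t2; have b1 := boost_base_gt1.
have t0 : 0 <= theta by lra.
have b0 : 0 <= boost_base by lra.
by apply: addr_ge0; [apply: mulr_ge0; rewrite ?subr_ge0 | apply: divr_ge0].
Qed.

Lemma boost_round (p : T * bool -> R) (g : G) : (forall z, 0 <= p z) ->
  theta * \sum_z p z <= \sum_(z | g z.1 == z.2) p z ->
  \sum_z p z * boost_factor g z <= boost_rate * \sum_z p z.
Proof.
move=> p0 hg; have b1 := boost_base_gt1.
have -> : \sum_z p z * boost_factor g z = boost_base * \sum_z p z
    - (boost_base - boost_base^-1) * \sum_(z | g z.1 == z.2) p z.
  rewrite [X in _ - _ * X]big_mkcond !mulr_sumr -sumrB; apply: eq_bigr => z _.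
  by rewrite /boost_factor; case: ifP => _; ring.
have bb : 0 <= boost_base - boost_base^-1.
  by rewrite subr_ge0 (le_trans _ (ltW b1)) // invf_le1 ?ltW //; lra.
by have := ler_wpM2l bb hg; rewrite /boost_rate; lra.
Qed.

(** With probability at least [c] the first draw has accuracy [theta] for the current weight and
    lowers the potential by [boost_rate]. The reweighted [p] is still good, so the same bound
    applies to the remaining draws. *)
Lemma boost_potential n (p : T * bool -> R) : (forall z, 0 <= p z) -> good p ->
  c ^+ n <= iid_prob n (fun s =>
    \sum_z p z * boost_weight s z <= boost_rate ^+ n * \sum_z p z).
Proof.
elim: n p => [|n IH] p p0 gp /=.
  suff -> : \sum_z p z * boost_weight [::] z <= boost_rate ^+ 0 * \sum_z p z by [].
  by rewrite mul1r ler_sum // => z _; rewrite /boost_weight big_nil mulr1.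
rewrite exprS; apply: le_trans (ler_wpM2r (exprn_ge0 _ c0) (weak p0 gp)) _.
rewrite big_mkcond mulr_suml; apply: ler_sum => g _.
case: ifP => [hg|_]; last by rewrite mul0r mulr_ge0 // iid_prob_ge0.
rewrite ler_wpM2l //.
have p'0 z : 0 <= p z * boost_factor g z.
  by rewrite mulr_ge0 // ltW // boost_factor_gt0.
have p'g : good (fun z => p z * boost_factor g z).
  by apply: good_reweigh => // z; apply: boost_factor_gt0.
apply: le_trans (IH _ p'0 p'g) _; apply: le_iid_prob => s h.
rewrite exprSr -mulrA.
apply: (@le_trans _ _ (boost_rate ^+ n * \sum_z p z * boost_factor g z)).
  apply: le_trans h.
  by apply: ler_sum => z _; rewrite /boost_weight big_cons mulrA.
by rewrite ler_wpM2l ?exprn_ge0 ?boost_rate_ge0 // boost_round.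
Qed.

Lemma boost_weight_mul (s : seq G) x :
  boost_weight s (x, true) * boost_weight s (x, false) = 1.
Proof.
have b1 := boost_base_gt1.
rewrite /boost_weight -big_split big1 // => g _ /=.
by rewrite /boost_factor /=; case: (g x); rewrite /= ?divff ?mulVf // gt_eqF //; lra.
Qed.

Lemma boost_weight_ge0 (s : seq G) z : 0 <= boost_weight s z.
Proof. by apply: prodr_ge0 => g _; rewrite ltW // boost_factor_gt0. Qed.

Lemma majority_error (s : seq G) z : majority s z.1 != z.2 -> 1 <= boost_weight s z.
Proof.
case: z => x y /=; rewrite ffunE.
have := boost_weight_mul s x.
have := boost_weight_ge0 s (x, true); have := boost_weight_ge0 s (x, false).
case: y; move: (boost_weight s (x, true)) (boost_weight s (x, false)) => a b b0 a0 ab;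
by case: leP => //= h _; rewrite leNgt; apply/negP => lt1; nra.
Qed.

Lemma exists_boost_rounds (eps : R) : 0 < eps -> exists n, boost_rate ^+ n <= eps.
Proof.
move=> e0; pose b := (boost_rate + 1) / 2.
have b0 : 0 < b by rewrite /b; have := boost_rate_ge0; lra.
have [|n _] := @exists_expr_gap _ 1 b eps^-1 b0.
  by rewrite /b; have := boost_rate_lt1; lra.
rewrite expr1n mulrC ltr_pdivrMr // mul1r => h; exists n.
apply: le_trans (ltW h); rewrite lerXn2r ?nnegrE ?boost_rate_ge0 ?(ltW b0) //.
by rewrite /b; have := boost_rate_lt1; lra.
Qed.

(** A point misclassified by the majority has [boost_weight] at least 1, so the final potential
    dominates the error. *)
Lemma boosting (eps : R) n (p : T * bool -> R) : boost_rate ^+ n <= eps ->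
  (forall z, 0 <= p z) -> good p ->
  c ^+ n <= \sum_(k : G | \sum_(z | k z.1 != z.2) p z <= eps * \sum_z p z)
     iid_prob n (fun s => majority s == k).
Proof.
move=> hn p0 gp; rewrite iid_prob_pushforward.
apply: le_trans (boost_potential n p0 gp) _; apply: le_iid_prob => s h.
apply: le_trans (le_trans h _); last by rewrite ler_wpM2r // sumr_ge0.
rewrite big_mkcond; apply: ler_sum => z _.
case: ifP => [/majority_error h1|_]; last by rewrite mulr_ge0 // boost_weight_ge0.
by rewrite -[leLHS]mulr1 ler_wpM2l.
Qed.

End Boosting.

(** * Duality for the fractional clique number *)

(** Take [t = (1 + s) / 2] with [s] so small that [(1 - s) ^+ m > y^-1]; then
    [(1 + s) ^+ m <= (1 - s) ^- m < y], where [y = v * 2 ^+ m]. *)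
Lemma exists_base_above_half (R : realType) (v : R) m :
  (2 ^- m) < v -> exists2 t : R, 1 / 2 < t <= 1 & t ^+ m < v.
Proof.
move=> hv; pose y := v * 2 ^+ m.
have y1 : 1 < y by rewrite /y -ltr_pdivrMr ?exprn_gt0 // mul1r.
pose s := (y - 1) / (y * m.+1%:R).
have y0 : 0 < y by lra.
have m0 : 0 < m.+1%:R :> R by rewrite ltr0n.
have s0 : 0 < s by apply: divr_gt0; [rewrite subr_gt0|exact: mulr_gt0].
have sm : s * m.+1%:R = 1 - y^-1 by rewrite /s; field; rewrite ?gt_eqF.
have yi : 0 < y^-1 by rewrite invr_gt0.
have m1 : 1 <= m.+1%:R :> R by rewrite ler1n.
have s1 : s <= 1.
  have : s <= s * m.+1%:R by rewrite ler_peMr // ltW.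
  by lra.
exists ((1 + s) / 2); first by apply/andP; split; lra.
rewrite expr_div_n ltr_pdivrMr ?exprn_gt0 // -/y.
have h1 : y^-1 < (1 - s) ^+ m.
  have := @bernoulli_ge _ (- s) m; move: sm; rewrite -natr1; lra.
have h2 : (1 + s) ^+ m * (1 - s) ^+ m <= 1.
  rewrite -exprMn exprn_ile1 //; first by rewrite mulr_ge0; lra.
  have := sqr_ge0 s; rewrite expr2; lra.
have h3 : 0 < (1 - s) ^+ m by apply: lt_trans h1.
have h4 : (1 + s) ^+ m <= ((1 - s) ^+ m)^-1.
  by rewrite -[leRHS]mul1r ler_pdivlMr.
by apply: le_lt_trans h4 _; rewrite -[ltRHS]invrK ltf_pV2 // posrE.
Qed.

Lemma esum_point (R : realType) (T : choiceType) (I : set T) (a : T) (c : \bar R) :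
  (0 <= c)%E ->
  (\esum_(i in I) (if a == i then c else 0) = if a \in I then c else 0)%E.
Proof.
move=> c0.
rewrite (eq_esum (b := fun i => if i \in [set a] then c else 0%E)); last first.
  move=> i _; suff -> : (i \in [set a]) = (a == i) by [].
  by apply/idP/eqP => [|->]; rewrite inE.
rewrite -(esum_mkcondr I [set a] (fun=> c)).
case: ifPn => [|]; rewrite ?inE ?notin_setE => aI.
  by rewrite setIC setIidl ?esum_set1 // => i ->.
by rewrite (_ : _ `&` _ = set0) ?esum_set0 // -subset0 => i [/= Ii ia]; rewrite ia in Ii.
Qed.

Section FiniteDomain.
Variables (R : realType) (X : countType) (H : set (X -> bool)).

Section Embedding.
Variables (m : nat) (L : seq X).
Local Notation T := (seq_sub L).

Definition emb_dataset (f : {ffun 'I_m -> T * bool}) : dataset X m :=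
  [tuple (val (f i).1, (f i).2) | i < m].

Definition realizable_fin (f : {ffun 'I_m -> T * bool}) : bool :=
  `[< realizable_data X H m (emb_dataset f) >].

Lemma mem_emb_dataset (f : {ffun 'I_m -> T * bool}) i :
  (val (f i).1, (f i).2) \in (emb_dataset f : seq _).
Proof. by apply/tnthP; exists i; rewrite tnth_mktuple. Qed.

Lemma esum_emb (I : set (dataset X m)) (w : {ffun 'I_m -> T * bool} -> R) :
  (forall f, 0 <= w f) ->
  (\esum_(S in I) (\sum_(f | realizable_fin f) if emb_dataset f == S then w f else 0)%:E
   = (\sum_(f | realizable_fin f && (emb_dataset f \in I)) w f)%:E)%E.
Proof.
move=> w0; under eq_esum do rewrite -sumEFin.
rewrite esum_sum; last by move=> S f _ _; case: ifP => _; rewrite lee_fin.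
rewrite [in RHS]big_mkcondr -sumEFin; apply: eq_bigr => f _.
under eq_esum do rewrite (fun_if EFin).
by rewrite esum_point ?lee_fin // (fun_if EFin).
Qed.

(** A weighting for which every [g] falls short, rescaled to total mass [r] and pushed to datasets,
    would be a fractional clique of size [r], contradicting the bound on the clique number. *)
Lemma frac_clique_best_response (r : R) : 0 < r ->
  (frac_clique_number R X H m < r%:E)%E ->
  forall w : {ffun 'I_m -> T * bool} -> R, (forall f, 0 <= w f) ->
  exists g, r^-1 * \sum_(f | realizable_fin f) w f <=
    \sum_(f | realizable_fin f && fits g f) w f.
Proof.
move=> r0 hr w w0; apply: contrapT => no.
have lt g : \sum_(f | realizable_fin f && fits g f) w f <
    r^-1 * \sum_(f | realizable_fin f) w f.
  by rewrite ltNge; apply/negP => h; apply: no; exists g.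
set W := \sum_(f | realizable_fin f) w f in lt.
have W0 : 0 < W.
  have : 0 < r^-1 * W.
    by apply: le_lt_trans (lt [ffun=> true]); rewrite sumr_ge0.
  by rewrite pmulr_rgt0 ?invr_gt0.
pose u f := w f * (r / W).
have u0 f : 0 <= u f by rewrite mulr_ge0 // divr_ge0 ?ltW.
pose d (S : dataset X m) : R :=
  \sum_(f | realizable_fin f) if emb_dataset f == S then u f else 0.
have d0 S : 0 <= d S by apply: sumr_ge0 => f _; case: ifP.
have clq : frac_clique R X H m d.
  split=> [//|I [Iv Ii]]; rewrite esum_emb // lee_fin.
  (* Independence of [I] means that no point receives both labels within [I], so this single
     labelling fits every dataset of [I]. *)
  pose g := [ffun x : T => `[< exists2 S, I S & (val x, true) \in (S : seq _) >]].
  apply: (@le_trans _ _ (\sum_(f | realizable_fin f && fits g f) u f)).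
    rewrite [leLHS]big_mkcond [leRHS]big_mkcond; apply: ler_sum => f _.
    case: ifP => [/andP[-> ]|_]; last by case: ifP.
    rewrite inE => If /=; case: ifPn => // /negP; case.
    apply/forallP => i; rewrite ffunE.
    have := mem_emb_dataset f i; case: (f i) => x [] /= xi.
      by rewrite eqb_id; apply/asboolP; exists (emb_dataset f).
    rewrite eqbF_neg; apply/asboolPn => -[S IS xS].
    by apply: (Ii _ _ If IS); left; exists (val x).
  rewrite -mulr_suml mulrA ler_pdivrMr // mul1r -ler_pdivlMr //.
  by rewrite mulrC; apply/ltW/lt.
have sz : frac_clique_size R X H m d = r%:E.
  rewrite /frac_clique_size esum_emb //; congr (_%:E).
  rewrite (eq_bigl realizable_fin) => [|f].
    by rewrite -mulr_suml -/W mulrCA divff ?mulr1 // gt_eqF.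
  by apply/andb_idr => /asboolP h; rewrite inE.
have : (r%:E <= frac_clique_number R X H m)%E.
  by rewrite -sz; apply: ereal_sup_ubound; exists d.
by rewrite leNgt hr.
Qed.

End Embedding.

Definition realizable_weight (L : seq X) (p : seq_sub L * bool -> R) :=
  exists2 h, H h & forall z, 0 < p z -> h (val z.1) = z.2.

(** Minimax, weak learning and boosting combined. The constants [r], [k], [theta] and [n] are all
    fixed before [L], so [c] is uniform over finite subdomains; the passage to the limit relies on
    this. *)
Lemma finite_representation m : (0 < m)%N ->
  (frac_clique_number R X H m < (2 ^ m)%:R%:E)%E ->
  forall eps : R, 0 < eps -> exists2 c : R, 0 < c &
  forall L : seq X, exists nu : {ffun seq_sub L -> bool} -> R,
  [/\ forall k, 0 <= nu k, \sum_k nu k = 1 &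
   forall p : seq_sub L * bool -> R, (forall z, 0 <= p z) -> realizable_weight p ->
   c <= \sum_(k : {ffun seq_sub L -> bool}
           | \sum_(z | k z.1 != z.2) p z <= eps * \sum_z p z) nu k].
Proof.
move=> m0 hw eps e0.
have [r [r1 r2m hr]] : exists r : R,
    [/\ 1 <= r, r < 2 ^+ m & (frac_clique_number R X H m < r%:E)%E].
  have m1 : 1 < 2 ^+ m :> R by rewrite exprn_egt1 ?ltr1n // -lt0n.
  move: hw; rewrite natrX; case: (frac_clique_number R X H m) => [w| |] //.
    rewrite lte_fin => hw; exists (Num.max 1 ((w + 2 ^+ m) / 2)).
    by rewrite le_max lexx gt_max lte_fin lt_max m1; split => //; last apply/orP; try right; lra.
  by exists 1; rewrite ltNyr.
have r0 : 0 < r by lra.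
have p2 : 0 < 2 ^+ m :> R by rewrite exprn_gt0.
pose s := 2 ^+ m / r - 1.
have s0 : 0 < s by rewrite subr_gt0 ltr_pdivlMr // mul1r.
(* This [k] places the rational [k.+1 / (2 ^ m * k)] strictly between [2 ^- m] and [r^-1]. *)
have [k k0 hk] : exists2 k : nat, (0 < k)%N & 1 < k%:R * s.
  exists (Num.bound s^-1).+1 => //; rewrite -ltr_pdivrMr // mul1r.
  apply: lt_trans (archi_boundP _) _; first by rewrite invr_ge0 ltW.
  by rewrite ltr_nat.
have kR : 0 < k%:R :> R by rewrite ltr0n.
have b0 : 0 < (2 ^ m * k)%:R :> R by rewrite natrM natrX mulr_gt0.
have ab : k.+1%:R < r^-1 * (2 ^ m * k)%:R.
  have -> : r^-1 * (2 ^ m * k)%:R = k%:R * s + k%:R.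
    by rewrite natrM natrX /s; field; rewrite gt_eqF.
  by rewrite -natr1; lra.
have hv : 2 ^- m < k.+1%:R / (2 ^ m * k)%:R :> R.
  rewrite ltr_pdivlMr // natrM natrX mulrA mulVf ?gt_eqF // mul1r ltr_nat //.
have [theta /andP[th2 th1] hth] := exists_base_above_half hv.
pose c0 := k.+1%:R / (2 ^ m * k)%:R - theta ^+ m.
have c00 : 0 < c0 by rewrite subr_gt0.
pose c := Num.min c0 1.
have cp : 0 < c by rewrite lt_min c00 ltr01.
have [n hn] := exists_boost_rounds th2 th1 e0.
exists (c ^+ n); first by rewrite exprn_gt0.
move=> L.
have b0n : (0 < 2 ^ m * k)%N by rewrite muln_gt0 expn_gt0.
have ri1 : r^-1 <= 1 by rewrite invf_le1.
have [nu0 [nu0_ge0 nu0_sum nu0_fits]] := @approximate_minimax R _ _ _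
  (fun f g => fits g f) _ (@frac_clique_best_response m L r r0 hr) _ _ ri1 b0n ab.
exists (fun g => iid_prob nu0 n (fun s => majority theta s == g)); split.
- by move=> g; apply: iid_prob_ge0.
- by rewrite (iid_prob_pushforward nu0 n (majority theta) predT); apply: iid_probT.
move=> p p0 rp.
apply: (@boosting R _ nu0 (@realizable_weight L) theta c) => //.
- exact: ltW.
- move=> p1 q [h Hh hp] q0; exists h => // z hz; apply: hp.
  by move: hz; rewrite pmulr_lgt0.
- move=> p1 p10 [h Hh hp1].
  apply: (weak_learner nu0_ge0 nu0_sum nu0_fits) => //.
  + by rewrite /c0 addrC subrK.
  + by lra.
  + move=> f hf; apply/asboolP; exists h => // z /tnthP[i ->].
    by rewrite tnth_mktuple /=; apply: hp1.
Qed.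

End FiniteDomain.

(** * A measure on hypotheses with prescribed finite-dimensional marginals *)

Lemma measurable_eval (X : countType) (x : X) (b : bool) :
  measurable ([set h | h x = b] : set (hypT X)).
Proof. by apply: sub_sigma_algebra; exists x, b. Qed.

Definition unit_lebesgue (R : realType) : set (measurableTypeR R) -> \bar R :=
  mrestr lebesgue_measure (measurable_itv `[0 : R, 1[).
Arguments unit_lebesgue : clear implicits.

HB.instance Definition _ (R : realType) := Measure.on (unit_lebesgue R).

Lemma unit_lebesgue_setT (R : realType) : unit_lebesgue R setT = 1%E.
Proof.
rewrite /unit_lebesgue /mrestr setTI lebesgue_measure_itv /= lte_fin ltr01.
by rewrite oppr0 adde0.
Qed.

HB.instance Definition _ (R : realType) :=
  Measure_isProbability.Build _ _ _ (unit_lebesgue R) (unit_lebesgue_setT R).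

Section MeasureOfMean.
Variables (R : realType) (X : countType) (L : set (X -> bool) -> R).
Hypotheses (L0 : forall A, 0 <= L A) (L1 : L setT = 1).
Hypothesis LID : forall A B, L A = L (A `&` B) + L (A `&` ~` B).

(** Views a hypothesis as a bit sequence indexed by [nat]; an index that encodes no point reads as
    [false]. *)
Definition coord (h : X -> bool) (i : nat) : bool :=
  if pickle_inv i is Some x then h x else false.

Lemma coord_pickle h x : coord h (pickle x) = h x.
Proof. by rewrite /coord pickleK_inv. Qed.

(* [s] lists the first [size s] coordinates in reverse order. *)
Fixpoint cyl (s : seq bool) : set (X -> bool) :=
  if s is b :: s' then cyl s' `&` [set h | coord h (size s') = b] else setT.

Lemma cyl_coord s h h' i : cyl s h -> cyl s h' -> (i < size s)%N ->
  coord h i = coord h' i.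
Proof.
elim: s => [//|b s IH] /= [hs hb] [hs' hb']; rewrite ltnS leq_eqVlt.
by move=> /orP[/eqP ->|/(IH hs hs')//]; rewrite hb hb'.
Qed.

Lemma measurable_cyl s : measurable (cyl s : set (hypT X)).
Proof.
elim: s => [|b s IH] /=; first exact: measurableT.
apply: measurableI => //; rewrite /coord; case: pickle_inv => [x|].
  exact: measurable_eval.
case: b.
- by rewrite (_ : [set _ | _] = set0) //; apply/seteqP; split.
- by rewrite (_ : [set _ | _] = setT); [exact: measurableT|apply/seteqP; split].
Qed.

Local Notation q s := (L (cyl s)).

Lemma mean_set0 : L set0 = 0.
Proof.
have := LID set0 set0; rewrite !set0I => h.
by apply: (@addrI _ (L set0)); rewrite addr0.
Qed.

Lemma mean_split A s :
  L (A `&` cyl s) = L (A `&` cyl (true :: s)) + L (A `&` cyl (false :: s)).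
Proof.
rewrite (LID _ [set h | coord h (size s) = true]) /= !setIA; congr (_ + L (_ `&` _)).
by apply/seteqP; split => h /=; case: (coord _ _).
Qed.

Lemma cyl_split s : q s = q (true :: s) + q (false :: s).
Proof. by have := mean_split setT s; rewrite !setTI. Qed.

(* The cylinders of each length partition [0, 1[ into consecutive intervals
   [left_end s, left_end s + L (cyl s)[; [address u n] is the one containing [u], so
   the hypothesis read off a uniform [u] has the marginals prescribed by [L]. *)
Fixpoint left_end (s : seq bool) : R :=
  if s is b :: s' then left_end s' + (if b then q (false :: s') else 0) else 0.

Fixpoint address (u : R) (n : nat) : seq bool :=
  if n is k.+1 then
    let s := address u k in (left_end s + q (false :: s) <= u) :: s
  else [::].

Lemma size_address u n : size (address u n) = n.
Proof. by elim: n => //= n ->. Qed.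

Lemma addressP (u : R) s : 0 <= u < 1 ->
  address u (size s) = s <-> left_end s <= u < left_end s + q s.
Proof.
move=> u01; elim: s => [|b s IH]; first by rewrite /= add0r L1 u01.
have sp := cyl_split s; have q1 := L0 (cyl (true :: s)); have q0 := L0 (cyl (false :: s)).
change (left_end (b :: s)) with (left_end s + (if b then q (false :: s) else 0)).
change (address u (size (b :: s))) with
  ((left_end (address u (size s)) + q (false :: address u (size s)) <= u)
    :: address u (size s)).
split=> [[] |].
  move=> hb hs; rewrite hs in hb; have /IH/andP[h1 h2] := hs.
  by case: b hb => hb; move: hb; [|move/negbT; rewrite -ltNge] => hb; apply/andP; split; lra.
move=> /andP[h1 h2].
have hs : address u (size s) = s by apply/IH/andP; split; case: b h1 h2 => h1 h2; lra.
rewrite hs; congr (_ :: _).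
by case: b h1 h2 => h1 h2; [|apply/negbTE; rewrite -ltNge]; lra.
Qed.

Definition sampled_hyp (u : measurableTypeR R) : hypT X :=
  fun x => head false (address u (pickle x).+1).

Lemma coord_sampled (u : R) n : 0 <= u < 1 ->
  coord (sampled_hyp u) n = head false (address u n.+1).
Proof.
move=> u01; rewrite /coord.
case E: (pickle_inv n) => [x|].
  by have := @pickle_invK X n; rewrite E /= => <-.
apply/esym/negbTE; rewrite /= -ltNge.
set s := address u n.
have /(addressP _ u01)/andP[_] : address u (size s) = s by rewrite size_address.
(* The index encodes no point, so the [true] branch is an empty cylinder of mass zero and its
   interval is empty. *)
suff : q (true :: s) = 0 by have := cyl_split s; lra.
rewrite -mean_set0; congr (L _); rewrite -subset0 => h [_].
by rewrite /= size_address /coord E.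
Qed.

Lemma cyl_sampled (u : R) s : 0 <= u < 1 -> cyl s (sampled_hyp u) <-> address u (size s) = s.
Proof.
move=> u01; elim: s => [//|b s IH] /=.
rewrite coord_sampled //; split=> [[/IH hs <-]|[hb hs]].
  by rewrite hs /= hs.
by split; [exact/IH|rewrite /= hb].
Qed.

(** The family [B] is arbitrary so that the induction can absorb the threshold test for the last bit
    into it. *)
Lemma measurable_address n (B : seq bool -> set R) :
  (forall s, measurable (B s)) -> measurable [set u | B (address u n) u].
Proof.
elim: n B => [|n IH] B mB /=; first exact: (mB [::]).
pose k s := left_end s + q (false :: s).
have := IH (fun s => ([set u | k s <= u] `&` B (true :: s)) `|`
                     ([set u | u < k s] `&` B (false :: s))).
rewrite (_ : [set _ | _] = [set u | B ((k (address u n) <= u) :: address u n) u]).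
  apply=> s; apply: measurableU; apply: measurableI => //.
    rewrite (_ : [set u | _] = [set` `[k s, +oo[]) //.
    by apply/seteqP; split => u /=; rewrite in_itv /= andbT.
  by rewrite (_ : [set u | _] = [set` `]-oo, k s[]).
apply/seteqP; split => u /=.
  by case=> -[]; [move=> ->|rewrite ltNge => /negbTE ->].
by case: leP => h; [left|right].
Qed.

Lemma measurable_sampled_hyp :
  measurable_fun [set: measurableTypeR R] sampled_hyp.
Proof.
refine (@measurability _ _ (measurableTypeR R) (hypT X) setT sampled_hyp _ erefl _).
move=> _ [_ [x [b ->]] <-]; rewrite setTI.
rewrite (_ : _ @^-1` _ =
  [set u : R | [set v : R | head false (address u (pickle x).+1) = b] u]) //.
apply: (@measurable_address (pickle x).+1 (fun s => [set v : R | head false s = b])) => s.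
case: (eqVneq (head false s) b) => [->|/eqP nb].
  by rewrite (_ : [set _ | _] = setT); [exact: measurableT|apply/seteqP; split].
by rewrite (_ : [set _ | _] = set0) //; apply/seteqP; split.
Qed.

Definition sampled_mfun : {mfun measurableTypeR R >-> hypT X} :=
  mfun_Sub (mem_set measurable_sampled_hyp).

Definition mean_measure : probability (hypT X) R :=
  distribution (unit_lebesgue R) sampled_mfun.

Lemma mean_measure_cyl s : mean_measure (cyl s) = (L (cyl s))%:E.
Proof.
have q0 := L0 (cyl s).
rewrite /mean_measure /= /distribution /pushforward /unit_lebesgue /mrestr.
rewrite (_ : _ `&` _ = [set` `[left_end s, left_end s + q s[]); last first.
  have bnd : forall t, 0 <= left_end t /\ left_end t + q t <= 1.
    elim=> [|b t [IH1 IH2]]; first by rewrite /= add0r L1.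
    have := cyl_split t; have := L0 (cyl (true :: t)); have := L0 (cyl (false :: t)).
    by case: b => /= *; split; lra.
  have [b0 b1] := bnd s.
  apply/seteqP; split => u /=; rewrite !in_itv /=.
    by move=> [hu u01]; apply/addressP => //; apply/cyl_sampled.
  move=> hu; have u01 : 0 <= u < 1 by case/andP: hu => *; apply/andP; split; lra.
  by split => //; apply/cyl_sampled => //; apply/addressP.
rewrite lebesgue_measure_itv /= lte_fin ltrDl.
case: ltP => [_|h]; first by rewrite -EFinB addrC addKr.
by congr (_%:E); apply/le_anti; rewrite h q0.
Qed.

(* [L] is only finitely additive, so it agrees with the measure on events determined
   by finitely many coordinates but not in general. *)
Lemma mean_measure_finite_dim (n : nat) (E : set (X -> bool)) :
  (forall h h', (forall x, (pickle x < n)%N -> h x = h' x) -> E h -> E h') ->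
  measurable (E : set (hypT X)) /\ mean_measure E = (L E)%:E.
Proof.
move=> hE.
(* [j] counts the coordinates still to be fixed. A cylinder of length [n] lies inside [E] or misses
   it, and additivity glues the two halves of a shorter one. *)
suff claim j s : (size s + j = n)%N ->
    measurable (E `&` cyl s : set (hypT X)) /\
    mean_measure (E `&` cyl s) = (L (E `&` cyl s))%:E.
  by have := claim n [::] erefl; rewrite /= setIT.
elim: j s => [|j IH] s sz.
  have [[h [Eh Ch]]|noE] := pselect (exists h, E h /\ cyl s h).
    rewrite (_ : E `&` cyl s = cyl s); last first.
      apply/seteqP; split => [h' []//|h' Ch']; split => //.
      apply: hE Eh => x xn; rewrite -!coord_pickle.
      by apply: (cyl_coord Ch Ch'); rewrite -(addn0 (size s)) sz.
    by split; [exact: measurable_cyl|exact: mean_measure_cyl].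
  rewrite (_ : E `&` cyl s = set0) ?measure0 ?mean_set0 //.
  by apply/seteqP; split => h // [Eh Ch]; apply: noE; exists h.
have [m1 e1] : measurable (E `&` cyl (true :: s) : set (hypT X)) /\ _ :=
  IH (true :: s) ltac:(by rewrite /= -sz addSnnS).
have [m0 e0] : measurable (E `&` cyl (false :: s) : set (hypT X)) /\ _ :=
  IH (false :: s) ltac:(by rewrite /= -sz addSnnS).
have EU : E `&` cyl s = (E `&` cyl (true :: s)) `|` (E `&` cyl (false :: s)).
  apply/seteqP; split => [h [Eh Ch]|h [[Eh [Ch _]]|[Eh [Ch _]]]] //=.
  by case C: (coord h (size s)); [left|right].
rewrite mean_split EFinD -e1 -e0 {1 2}EU; split; first exact: measurableU.
rewrite measureU // -subset0 => h [[_ [_ +]] [_ [_]]] /=.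
by move=> ->.
Qed.

End MeasureOfMean.

(** * Representation by ultrafilter limits *)

Definition finite_mean (R : realType) (T : Type) (L : set T -> R) :=
  [/\ forall A, 0 <= L A, L setT = 1 &
      forall A B, L A = L (A `&` B) + L (A `&` ~` B)].

Lemma ultra_fmap (T U : Type) (f : T -> U) (F : set_system T) :
  UltraFilter F -> UltraFilter (f @ F).
Proof.
move=> FU; have PF := @ultra_proper _ _ FU.
split=> [|G GF sFG]; first exact: fmap_proper_filter.
rewrite predeqE => A; split=> [GA|]; last exact: sFG.
have [//|FnA] := in_ultra_setVsetC (f @^-1` A) FU.
by have /filter_ex[? []] : G (A `&` ~` A) by apply: filterI => //; apply: sFG.
Qed.

(** Along an ultrafilter refining [\oo] every sequence in [[0, 1]] converges by compactness. Limits
    preserve finite additivity and lower bounds that hold eventually. *)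
Lemma finite_mean_limit (R : realType) (T : Type) (P : nat -> set T -> R) :
  (forall k, finite_mean (P k)) ->
  exists2 L : set T -> R, finite_mean L &
  forall (E : set T) (c : R) (N : nat),
    (forall k, (N <= k)%N -> c <= P k E) -> c <= L E.
Proof.
move=> mP.
have [U [Uult ooU]] := ultraFilterLemma (@eventually_filter : ProperFilter \oo).
have PU := @ultra_proper _ _ Uult.
have lim_ex E : exists l : R, P ^~ E @ U --> l.
  have := @segment_compact R 0 1; rewrite compact_ultra.
  have ultra_im := @ultra_fmap _ _ (P ^~ E) _ Uult.
  move=> /(_ _ ultra_im) h.
  have [|l [_ hl]] := h; last by exists l.
  apply: (@filterS _ U _ setT); last exact: filterT.
  move=> k _ /=; rewrite in_itv /=; have [P0 P1 PI] := mP k.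
  rewrite P0 /= -P1 [leRHS](PI _ E) setTI lerDl; exact: P0.
have [L hL] := choice lim_ex.
have Lge (E : set T) (c : R) (N : nat) :
    (forall k, (N <= k)%N -> c <= P k E) -> c <= L E.
  move=> h; apply: (cvgr_to_ge (hL E)); apply: ooU.
  by exists N => // k /= /h.
exists L => //; split.
- by move=> A; apply: (Lge _ _ 0%N) => k _; have [] := mP k.
- have c1 : P ^~ setT @ U --> (1 : R).
    rewrite (_ : P ^~ setT = fun=> 1); first exact: cvg_cst.
    by apply/funext => k; have [] := mP k.
  exact: (cvg_unique _ (hL setT) c1).
- move=> A B; apply: (cvg_unique _ (hL A)) => //.
  rewrite (_ : P ^~ A = (fun k => P k (A `&` B) + P k (A `&` ~` B))).
    exact: cvgD (hL _) (hL _).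
  by apply/funext => k; have [_ _ /(_ A B)] := mP k.
Qed.

Lemma sum_count_mem_inj (R : pzSemiRingType) (Z : finType) (Y : eqType) (i : Z -> Y)
    (Q : pred Y) (s : seq Y) : injective i ->
  (forall y, y \in s -> exists z, i z = y) ->
  \sum_(z | Q (i z)) (count_mem (i z) s)%:R = (count Q s)%:R :> R.
Proof.
move=> inj_i; elim: s => [|y s IH] hs; first by rewrite big1.
have [z0 z0y] := hs y (mem_head _ _).
under eq_bigr do rewrite /= natrD.
rewrite big_split /= natrD IH => [|y' y's]; last by apply: hs; rewrite inE y's orbT.
congr (_ + _); rewrite -z0y big_mkcond (bigD1 z0) //= eqxx big1 ?addr0.
  by case: (Q _).
by move=> z zz0; rewrite (inj_eq inj_i) eq_sym (negPf zz0) if_same.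
Qed.

Definition err (X : countType) (h : X -> bool) (s : seq (X * bool)) : nat :=
  count (fun z => h z.1 != z.2) s.

Definition domain_upto (X : countType) (k : nat) : seq X := pmap pickle_inv (iota 0 k).

Lemma mem_domain_upto (X : countType) k (x : X) :
  (pickle x < k)%N -> x \in domain_upto X k.
Proof.
move=> xk; rewrite mem_pmap; apply/mapP; exists (pickle x).
  by rewrite mem_iota.
by rewrite pickleK_inv.
Qed.

Definition extend (X : countType) (s : seq X) (g : {ffun seq_sub s -> bool}) : X -> bool :=
  fun x => oapp g false (insub x).

Lemma extend_val (X : countType) (s : seq X) (g : {ffun seq_sub s -> bool}) t :
  extend g (val t) = g t.
Proof. by rewrite /extend valK. Qed.

Definition low_error (R : realType) (X : countType) (eps : R) (n : nat)
    (S : dataset X n) : set (X -> bool) :=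
  [set h | (err h S)%:R <= eps * n%:R].

Definition represents (R : realType) (X : countType) (H : set (X -> bool))
    (mu : probability (hypT X) R) (eps c : R) :=
  forall n (S : dataset X n), realizable_data X H n S ->
    (c%:E <= mu (low_error eps S))%E.

Lemma err_local (X : countType) (s : seq (X * bool)) : exists N : nat,
  (forall z, z \in s -> pickle z.1 < N)%N /\
  forall h h' : X -> bool, (forall x, (pickle x < N)%N -> h x = h' x) ->
  err h s = err h' s.
Proof.
pose N := (\max_(z <- s) pickle z.1).+1.
have hN z : z \in s -> (pickle z.1 < N)%N.
  by move=> zs; rewrite ltnS; apply: (@leq_bigmax_seq _ s predT (fun z => pickle z.1)).
exists N; split => // h h' hh'; apply: eq_in_count => z /hN/hh' ->.
by [].
Qed.

(** The finite representations on [domain_upto X k], extended by [false], have a limit mean. An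
    event [low_error eps S] depends on finitely many coordinates, so the countably additive
    [mean_measure] gives it the value of that mean. *)
Lemma exists_representation (R : realType) (X : countType) (H : set (X -> bool)) m :
  (0 < m)%N -> (frac_clique_number R X H m < (2 ^ m)%:R%:E)%E ->
  forall eps : R, 0 < eps -> exists2 c : R, 0 < c &
  exists mu : probability (hypT X) R, represents H mu eps c.
Proof.
move=> m0 hw eps e0.
have [c c0 hfin] := finite_representation m0 hw e0.
exists c => //.
have /all_sig[nu hnu] k := cid (hfin (domain_upto X k)).
pose P k (E : set (X -> bool)) : R :=
  \sum_(g : {ffun seq_sub (domain_upto X k) -> bool}) nu k g * `[< E (extend g) >]%:R.
have mP k : finite_mean (P k).
  have [nu0 nu1 _] := hnu k; split.
  - by move=> A; apply: sumr_ge0 => g _; rewrite mulr_ge0.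
  - by rewrite -nu1; apply: eq_bigr => g _; rewrite asboolT // mulr1.
  - move=> A B; rewrite -big_split; apply: eq_bigr => g _ /=.
    rewrite -mulrDr; congr (_ * _); rewrite !asbool_and asbool_neg.
    by case: asboolP; case: asboolP => /=; rewrite ?addr0 ?add0r.
have [L [L0 L1 LI] Lge] := finite_mean_limit mP.
exists (mean_measure L) => n S [h Hh hS].
have [N [SN errN]] := err_local (S : seq (X * bool)).
have [|_ ->] := @mean_measure_finite_dim R X L L0 L1 LI N (low_error eps S).
  by move=> g g' /errN; rewrite /low_error /= => ->.
rewrite lee_fin; apply: (Lge _ _ N) => k Nk.
have [nu0 nu1 hk] := hnu k.
pose i (z : seq_sub (domain_upto X k) * bool) := (val z.1, z.2).
have inj_i : injective i by move=> [x b] [x' b'] [/val_inj -> ->].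
have surj y : y \in (S : seq _) -> exists z, i z = y.
  move=> yS; have yd : y.1 \in domain_upto X k.
    by apply: mem_domain_upto; apply: leq_trans (SN _ yS) Nk.
  by exists (SeqSub yd, y.2); case: y yS yd.
(* Multiplicities in the sample: the total weight is [n], and the weighted error is the number of
   mistakes. *)
pose p z : R := (count_mem (i z) S)%:R.
have rp : realizable_weight H p.
  exists h => // z; rewrite /p ltr0n -has_count has_pred1 => /hS.
  by [].
apply: le_trans (hk p (fun=> ler0n _ _) rp) _.
rewrite big_mkcond; apply: ler_sum => g _.
case: ifP => [hg|_]; last by rewrite mulr_ge0.
rewrite asboolT ?mulr1 // /low_error /=.
have tot : \sum_z p z = n%:R.
  by rewrite (sum_count_mem_inj _ predT inj_i surj) count_predT size_tuple.
rewrite -tot; apply: le_trans hg; rewrite /err -(sum_count_mem_inj _ _ inj_i surj).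
by under eq_bigl do rewrite /= extend_val.
Qed.

(** * The exponential mechanism *)

Lemma esumZl (R : realType) (T : choiceType) (I : set T) (a : T -> \bar R) (r : R) :
  0 <= r -> (forall i, 0 <= a i)%E ->
  (\esum_(i in I) (r%:E * a i) = r%:E * \esum_(i in I) a i)%E.
Proof.
move=> r0 a0; rewrite /esum -ereal_supZl //.
  congr ereal_sup; apply/seteqP; split.
    by move=> _ [A Af <-]; exists (\sum_(x \in A) a x)%E; [exists A|rewrite ge0_mule_fsumr].
  by move=> _ [_ [A Af <-] <-]; exists A; rewrite // ge0_mule_fsumr.
apply/set0P; exists (\sum_(x \in set0) a x)%E; exists set0 => //.
exact: fsets_set0.
Qed.

(** Sums over i.i.d. samples factorize. This serves both for the total mass of the sample law and
    for the exponential moment of the empirical error. *)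
Lemma esum_tuple_prod (R : realType) (T : choiceType) (f : T -> R) (s : R) n :
  (forall z, 0 <= f z) -> (\esum_(z in [set: T]) (f z)%:E = s%:E)%E ->
  (\esum_(S in [set: n.-tuple T]) (\prod_(z <- S) f z)%:E = (s ^+ n)%:E)%E.
Proof.
move=> f0 fs; elim: n => [|n IH].
  rewrite (_ : [set: 0.-tuple T] = [set [tuple]]).
    by rewrite esum_set1 ?big_nil ?lee_fin.
  by apply/seteqP; split => // t _ /=; rewrite tuple0.
pose e (x : T * n.-tuple T) : n.+1.-tuple T := [tuple of x.1 :: x.2].
rewrite (@reindex_esum _ _ _ ([set: T] `*`` (fun=> [set: n.-tuple T])) setT e); last first.
  split=> //.
    move=> [x t] [x' t'] _ _ /(congr1 val) /= [-> tt'].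
    by congr (_, _); apply: val_inj.
  move=> t _; exists (thead t, [tuple of behead t]) => //.
  by rewrite /e /= -tuple_eta.
under eq_esum do rewrite /e /= big_cons.
rewrite -(@esum_esum _ _ _ _ _ (fun x (t : n.-tuple T) => (f x * \prod_(z <- t) f z)%:E)).
  under eq_esum => x _.
    under eq_esum do rewrite EFinM.
    rewrite esumZl // => [|t]; last by rewrite lee_fin prodr_ge0.
    rewrite IH muleC.
    over.
  rewrite esumZl ?exprn_ge0 // ?fs -?EFinM ?exprSr //.
  by rewrite -lee_fin -fs esum_ge0 // => z _; rewrite lee_fin.
by move=> x t _ _; rewrite lee_fin mulr_ge0 // prodr_ge0.
Qed.

(** Reduces a bound on an infinite sum to countably many conditions on finitely many coordinates,
    which makes loss events measurable. *)
Lemma loss_sum_le (R : realType) (X : countType) (p : X * bool -> R) (a : R)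
    (h : X -> bool) : (forall z, 0 <= p z) ->
  (loss R X p h <= a%:E)%E <-> forall k,
  \sum_(z <- undup (domain_upto _ k) | h z.1 != z.2) p z <= a.
Proof.
move=> p0; split.
  move=> hl k; rewrite -lee_fin; apply: le_trans hl; rewrite /loss.
  apply: esum_ge; set s := [seq z <- undup (domain_upto _ k) | h z.1 != z.2].
  exists [set` s].
    by split=> [|z /=]; [exact: finite_seq|rewrite mem_filter => /andP[]].
  by rewrite -fsbig_seq ?filter_uniq ?undup_uniq // big_filter -sumEFin.
move=> hk; apply: ge_ereal_sup => _ [A [fA AI] <-].
have [N hN] : exists N, forall z, A z -> (pickle z < N)%N.
  have /finite_seqP[t ->] := fA.
  exists (\max_(z <- t) pickle z).+1 => z zt; rewrite ltnS.
  exact: (@leq_bigmax_seq _ t predT pickle).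
have := hk N; rewrite -lee_fin; apply: le_trans.
set s := [seq z <- undup (domain_upto _ N) | h z.1 != z.2].
rewrite -sumEFin -[leRHS]big_filter -/s [leRHS]fsbig_seq ?filter_uniq ?undup_uniq //.
apply: lee_fsum_nneg_subset => //.
- move=> z; rewrite !inE => Az; rewrite /= mem_filter mem_undup mem_domain_upto ?hN //.
  by rewrite andbT; apply: AI.
- by move=> z _; rewrite lee_fin.
Qed.

Lemma measurable_mismatch (X : countType) (x : X) (b : bool) :
  measurable ([set h | h x != b] : set (hypT X)).
Proof.
rewrite (_ : [set _ | _] = [set h : hypT X | h x = ~~ b]); first exact: measurable_eval.
by apply/seteqP; split => h /=; case: (h x); case: b.
Qed.

Lemma measurable_mismatch_fun (R : realType) (X : countType) (z : X * bool) (a b : R) :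
  measurable_fun setT (fun h : hypT X => if h z.1 != z.2 then a else b).
Proof.
rewrite (_ : (fun _ => _) = (fun h : hypT X => b + (a - b) * \1_[set h | h z.1 != z.2] h)).
  apply: measurable_funD => //; apply: measurable_funM => //.
  by apply: measurable_indic; apply: measurable_mismatch.
apply/funext => h; rewrite indicE.
case: ifPn => hz; first by rewrite mem_set // mulr1 addrC subrK.
by rewrite memNset ?mulr0 ?addr0 //; apply/negP.
Qed.

Lemma measurable_loss_gt (R : realType) (X : countType) (p : X * bool -> R) (a : R) :
  (forall z, 0 <= p z) ->
  measurable ([set h | (a%:E < loss R X p h)%E] : set (hypT X)).
Proof.
move=> p0.
pose f k (h : hypT X) := \sum_(z <- undup (domain_upto _ k)) if h z.1 != z.2 then p z else 0.
rewrite (_ : [set _ | _] = ~` \bigcap_k (f k @^-1` `]-oo, a])).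
  apply: measurableC; apply: bigcapT_measurable => k; rewrite -[X in measurable X]setTI.
  have mf : measurable_fun setT (f k).
    by apply: measurable_sum => z; apply: measurable_mismatch_fun.
  exact: mf.
apply/seteqP; split => h /=.
  move=> hl hc; move: hl; rewrite ltNge => /negP; apply; apply/loss_sum_le => // k.
  by have := hc k I; rewrite /= in_itv /= /f -big_mkcond.
move=> hc; rewrite ltNge; apply/negP => hl; apply: hc => k _ /=.
by rewrite in_itv /= /f -big_mkcond; move: hl => /loss_sum_le; apply.
Qed.

(** This is [expR (- err h s)], written as a product so that it multiplies example by example with
    [sample_prob]. *)
Definition tilt_weight (R : realType) (X : countType) (s : seq (X * bool))
  (h : hypT X) : R := \prod_(z <- s) if h z.1 != z.2 then expR (-1) else 1.

Section Tilt.
Variables (R : realType) (X : countType).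
Implicit Types (s : seq (X * bool)) (h : hypT X).
Local Notation wt := (@tilt_weight R X).

Lemma tilt_weightE s h : wt s h = expR (- (err h s)%:R).
Proof.
rewrite /tilt_weight /err; elim: s => [|z s IH]; first by rewrite big_nil oppr0 expR0.
rewrite big_cons IH /= natrD opprD expRD.
by case: (h z.1 != z.2); rewrite ?oppr0 ?expR0.
Qed.

Lemma tilt_weight_gt0 s h : 0 < wt s h. Proof. by rewrite tilt_weightE expR_gt0. Qed.

Lemma tilt_weight_le1 s h : wt s h <= 1.
Proof. by rewrite tilt_weightE -expR0 ler_expR oppr_le0. Qed.

Lemma tilt_weight_ge s h : expR (- (size s)%:R) <= wt s h.
Proof. by rewrite tilt_weightE ler_expR lerN2 ler_nat count_size. Qed.

Lemma measurable_tilt_weight s : measurable_fun setT (fun h => (wt s h)%:E).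
Proof.
apply: measurableT_comp => //; apply: measurable_prod => z _.
apply: measurable_mismatch_fun.
Qed.

Lemma measurable_low_error (eps : R) n (S : dataset X n) :
  measurable (low_error eps S : set (hypT X)).
Proof.
have := emeasurable_fun_c_infty measurableT (measurable_tilt_weight S)
  (expR (- (eps * n%:R)))%:E.
rewrite setTI (_ : [set h | _] = low_error eps S) //.
by apply/seteqP; split => h /=; rewrite lee_fin tilt_weightE ler_expR lerN2.
Qed.

Lemma tilt_weight_neighbors n (S S' : dataset X n) h : neighbors X n S S' ->
  wt S h <= expR 1 * wt S' h.
Proof.
move=> [i hi]; rewrite /tilt_weight !big_tuple (bigD1 i) //= [X in _ <= _ * X](bigD1 i) //=.
rewrite mulrA; under [X in _ * X <= _]eq_bigr => j ji do rewrite hi //.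
apply: ler_wpM2r.
  by apply: prodr_ge0 => j _; case: ifP; rewrite ?expR_ge0.
have e1 : 1 <= expR 1 :> R by rewrite -expR0 ler_expR.
have em : expR (-1) <= 1 :> R by rewrite -[leRHS]expR0 ler_expR lerN10.
have ee : expR 1 * expR (-1) = 1 :> R by rewrite -expRD subrr expR0.
by do 2 case: ifP => _; rewrite ?ee ?mulr1 //; apply: (le_trans em).
Qed.

Variable mu : probability (hypT X) R.

Definition tilted s (E : set (hypT X)) : \bar R := (\int[mu]_(h in E) (wt s h)%:E)%E.

Let tilted0 s : tilted s set0 = 0%E. Proof. exact: integral_set0. Qed.

Let wt0 s h : (0 <= (wt s h)%:E)%E. Proof. by rewrite lee_fin ltW // tilt_weight_gt0. Qed.

Let tilted_ge0 s E : (0 <= tilted s E)%E. Proof. by apply: integral_ge0. Qed.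

Let tilted_sigma_additive s : semi_sigma_additive (tilted s).
Proof. by apply: semi_sigma_additive_nng_induced => //; apply: measurable_tilt_weight. Qed.

HB.instance Definition _ s := isMeasure.Build _ _ _ (tilted s)
  (tilted0 s) (tilted_ge0 s) (@tilted_sigma_additive s).

Definition exp_mechanism s : probability (hypT X) R := mnormalize (tilted s) mu.

Lemma tilted_ge s E (a : R) : measurable E -> 0 <= a ->
  (forall h, E h -> a <= wt s h) -> (a%:E * mu E <= tilted s setT)%E.
Proof.
move=> mE a0 ha; rewrite -integral_cst //.
apply: (@le_trans _ _ (tilted s E)); last first.
  by apply: ge0_subset_integral => //; apply: measurable_tilt_weight.
apply: ge0_le_integral => //.
  by apply: measurable_funTS; apply: measurable_tilt_weight.
Qed.

Lemma tilted_le1 s E : measurable E -> (tilted s E <= 1)%E.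
Proof.
move=> mE.
have h1 : (tilted s E <= \int[mu]_(h in E) (cst 1 h))%E.
  apply: ge0_le_integral => //.
  - by apply: measurable_funTS; apply: measurable_tilt_weight.
  - by move=> h _; rewrite lee_fin tilt_weight_le1.
by apply: le_trans h1 _; rewrite integral_cst // mul1e; apply: probability_le1.
Qed.

Lemma tilted_fin_num s E : measurable E -> tilted s E \is a fin_num.
Proof.
by move=> mE; rewrite ge0_fin_numE //; apply: le_lt_trans (tilted_le1 _ mE) _; rewrite ltry.
Qed.

Definition tilt_mass s : R := fine (tilted s setT).

Lemma tilt_massE s : tilted s setT = (tilt_mass s)%:E.
Proof. by rewrite fineK // tilted_fin_num //. Qed.

Lemma tilt_mass_gt0 s : 0 < tilt_mass s.
Proof.
rewrite -lte_fin -tilt_massE.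
apply: lt_le_trans (tilted_ge (a := expR (- (size s)%:R)) measurableT _ _).
- by rewrite probability_setT mule1 lte_fin expR_gt0.
- exact: expR_ge0.
- by move=> h _; apply: tilt_weight_ge.
Qed.

Lemma exp_mechanismE s E : exp_mechanism s E = (tilted s E * (tilt_mass s)^-1%:E)%E.
Proof.
(* [mnormalize] branches on a zero or infinite total mass; here the mass is positive and finite. *)
rewrite /exp_mechanism /= /mnormalize /= ifF //.
by rewrite [tilted _ _]tilt_massE orbF gt_eqF // lte_fin tilt_mass_gt0.
Qed.

Lemma tilted_neighbors n (S S' : dataset X n) E : neighbors X n S S' -> measurable E ->
  (tilted S E <= (expR 1)%:E * tilted S' E)%E.
Proof.
move=> nb mE; rewrite /tilted -ge0_integralZl //; last first.
  by apply: measurable_funTS; apply: measurable_tilt_weight.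
apply: ge0_le_integral => //.
- by apply: measurable_funTS; apply: measurable_tilt_weight.
- apply: measurable_funTS; apply: emeasurable_funM => //.
  exact: measurable_tilt_weight.
- by move=> h _; rewrite -EFinM lee_fin tilt_weight_neighbors.
Qed.

Lemma neighbors_sym n (S S' : dataset X n) : neighbors X n S S' -> neighbors X n S' S.
Proof. by move=> [i hi]; exists i => j /hi. Qed.

(** Changing one example moves the numerator and the normalizing mass by a factor at most [expR 1]
    each. *)
Lemma exp_mechanism_dp n (S S' : dataset X n) E : neighbors X n S S' -> measurable E ->
  (exp_mechanism S E <= (expR 2)%:E * exp_mechanism S' E)%E.
Proof.
move=> nb mE; rewrite !exp_mechanismE.
have := tilted_neighbors nb mE.
have := tilted_neighbors (neighbors_sym nb) measurableT; rewrite !tilt_massE -EFinM lee_fin.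
rewrite -(fineK (tilted_fin_num S mE)) -(fineK (tilted_fin_num S' mE)) -!EFinM !lee_fin.
have Z0 := tilt_mass_gt0 S; have Z0' := tilt_mass_gt0 S'.
have N0' : 0 <= fine (tilted S' E) by rewrite fine_ge0.
move: (fine _) (fine _) N0' (tilt_mass S) (tilt_mass S') Z0 Z0' => N N' N0' Z Z' Z0 Z0' ZZ NN.
rewrite ler_pdivrMr // (_ : expR 2 = expR 1 * expR 1 :> R); last by rewrite -expRD.
apply: le_trans NN _.
rewrite -!mulrA ler_wpM2l ?expR_ge0 // mulrCA ler_peMr // mulrCA mulrC.
by rewrite ler_pdivlMr // mul1r.
Qed.

(** The low-error event has [mu]-mass at least [c] and weight at least [expR (- (eps * n))], which
    bounds the normalizing mass from below. *)
Lemma exp_mechanism_realizable (H : set (X -> bool)) (eps c : R) n (S : dataset X n) E :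
  0 < c -> represents H mu eps c -> realizable_data X H n S -> measurable E ->
  (exp_mechanism S E <= (c^-1 * expR (eps * n%:R))%:E * tilted S E)%E.
Proof.
move=> c0 rep rS mE; rewrite exp_mechanismE muleC lee_wpmul2r // lee_fin.
have Z0 := tilt_mass_gt0 S.
have mlow := measurable_low_error eps S.
have := tilted_ge (s := S) (a := expR (- (eps * n%:R))) mlow (expR_ge0 _).
have h1 h : low_error eps S h -> expR (- (eps * n%:R)) <= wt S h.
  by rewrite /low_error /= => hl; rewrite tilt_weightE ler_expR lerN2.
move=> /(_ h1); rewrite tilt_massE => h2.
have : ((c * expR (- (eps * n%:R)))%:E <= (tilt_mass S)%:E)%E.
  apply: le_trans h2; rewrite mulrC EFinM lee_wpmul2l ?lee_fin ?expR_ge0 //.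
  exact: rep.
rewrite lee_fin => h3.
rewrite -(invrK (expR (eps * n%:R))) -expRN -invfM lef_pV2 // posrE //.
by rewrite mulr_gt0 // expR_gt0.
Qed.

End Tilt.

(** * Accuracy of the exponential mechanism *)

Section Accuracy.
Variables (R : realType) (X : countType) (H : set (X -> bool)).
Variables (p : X * bool -> R).
Hypotheses (p_pmf : is_pmf R X p) (p_rz : realizable_dist R X H p).

Lemma sample_prob_ge0 n (S : dataset X n) : 0 <= sample_prob R X p n S.
Proof. by have [p0 _] := p_pmf; apply: prodr_ge0. Qed.

(** The infimum of the losses need not be attained, but a hypothesis whose loss is below the least
    mass of a sampled example errs on none of them. *)
Lemma sample_realizable n (S : dataset X n) :
  sample_prob R X p n S != 0 -> realizable_data X H n S.
Proof.
have [p0 _] := p_pmf.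
move=> Sn0.
have Spos z : z \in (S : seq _) -> 0 < p z.
  move=> zS; rewrite lt0r p0 andbT; apply: contra_neq Sn0 => pz.
  by rewrite /sample_prob (perm_big _ (perm_to_rem zS)) big_cons /= pz mul0r.
have [d d0 hd] : exists2 d : R, 0 < d & forall z, z \in (S : seq _) -> d <= p z.
  elim: (S : seq _) Spos => [|z s IH] Spos; first by exists 1.
  have [|d d0 hd] := IH; first by move=> y ys; apply: Spos; rewrite inE ys orbT.
  exists (Num.min d (p z)); first by rewrite lt_min d0 Spos ?mem_head.
  move=> y; rewrite inE => /orP[/eqP ->|/hd h]; rewrite ge_min ?lexx ?orbT //.
  by rewrite h.
have : (ereal_inf [set loss R X p h | h in H] < d%:E)%E by rewrite p_rz lte_fin.
move=> /ereal_inf_lt [_ [h Hh <-] hl]; exists h => // z zS.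
apply/eqP; rewrite -[_ == _]negbK; apply/negP => hz.
move: hl; rewrite ltNge => /negP; apply.
apply: (@le_trans _ _ (p z)%:E); first by rewrite lee_fin hd.
apply: esum_ge; exists [set z]; last by rewrite fsbig_set1.
by split; [exact: finite_set1|move=> y ->].
Qed.

Lemma esum_sample_prob n : (\esum_(S in [set: dataset X n]) (sample_prob R X p n S)%:E = 1)%E.
Proof. by have [p0 p1] := p_pmf; rewrite (esum_tuple_prod _ p0 p1) expr1n. Qed.

(** By independence the sum is [(1 - (1 - expR (-1)) * l) ^+ n] with [l] the loss, and
    [1 - expR (-1) >= 1 / 2]. *)
Lemma esum_sample_tilt n (h : hypT X) (a : R) : (a%:E < loss R X p h)%E -> 0 <= a ->
  (\esum_(S in [set: dataset X n]) (sample_prob R X p n S * tilt_weight R S h)%:E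
   <= (expR (- (a / 2) * n%:R))%:E)%E.
Proof.
have [p0 p1] := p_pmf; move=> ha a0.
pose W := [set z : X * bool | h z.1 != z.2].
have pe z : (0 <= (p z)%:E)%E by rewrite lee_fin.
have := esumID W setT (fun z => (p z)%:E) (fun z _ => pe z).
rewrite p1 !setTI => pW.
have l_le1 : (loss R X p h <= 1)%E.
  by rewrite /loss -/W pW leeDl // esum_ge0.
have l_fin : loss R X p h \is a fin_num.
  rewrite ge0_fin_numE; first by apply: le_lt_trans l_le1 _; rewrite ltry.
  by apply: esum_ge0.
pose l := fine (loss R X p h).
have lE : (\esum_(z in W) (p z)%:E = l%:E)%E by rewrite fineK.
have corr : (\esum_(z in ~` W) (p z)%:E = (1 - l)%:E)%E.
  by rewrite EFinB pW lE (addeC l%:E) addeK.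
pose f z : R := p z * (if h z.1 != z.2 then expR (-1) else 1).
have f0 z : 0 <= f z by rewrite mulr_ge0 //; case: ifP; rewrite ?expR_ge0.
have fs : (\esum_(z in setT) (f z)%:E = (1 - (1 - expR (-1)) * l)%:E)%E.
  rewrite (esumID W) => [|z _]; last by rewrite lee_fin.
  rewrite !setTI.
  rewrite (eq_esum (b := fun z => (expR (-1))%:E * (p z)%:E)%E); last first.
    by move=> z; rewrite /W /f /= => ->; rewrite mulrC EFinM.
  rewrite esumZl ?expR_ge0 // lE.
  rewrite (eq_esum (I := ~` W) (b := fun z => (p z)%:E)); last first.
    by move=> z /negP; rewrite /W /f /= => /negbTE ->; rewrite mulr1.
  by rewrite corr -EFinM -EFinD; congr (_%:E); ring.
under eq_esum do rewrite /sample_prob /tilt_weight -big_split /=.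
rewrite (esum_tuple_prod n f0 fs) lee_fin expRM_natr.
have al : a < l by rewrite -lte_fin -lE.
have l1 : l <= 1 by rewrite -lee_fin -lE.
have e2 : expR (-1) <= 1 / 2 :> R.
  rewrite expRN div1r lef_pV2 ?posrE ?expR_gt0 //.
  by have := @expR_ge1Dx R 1; lra.
have e0 := @expR_gt0 R (-1).
apply: lerXn2r; rewrite ?nnegrE ?expR_ge0 //; first by nra.
apply: le_trans (expR_ge1Dx _); nra.
Qed.

Variables (mu : probability (hypT X) R) (eps c : R).
Hypotheses (c0 : 0 < c) (eps0 : 0 <= eps) (rep : represents H mu eps c).

(** Normalizing costs [c^-1 * expR (eps * n)], while a hypothesis of loss above [4 * eps] has
    expected tilt at most [expR (- 2 * eps * n)]. *)
Lemma fail_prob_exp_mechanism n :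
  (fail_prob R X (fun m S => exp_mechanism mu (S : dataset X m)) p n (4 * eps)
   <= (c^-1 * expR (- eps * n%:R))%:E)%E.
Proof.
have [p0 p1] := p_pmf.
set B := [set h : hypT X | ((4 * eps)%:E < loss R X p h)%E].
have mB : measurable B by apply: measurable_loss_gt.
pose K := c^-1 * expR (eps * n%:R).
have K0 : 0 <= K by rewrite mulr_ge0 ?expR_ge0 // invr_ge0 ltW.
have wt0 S (h : hypT X) : 0 <= tilt_weight R S h by rewrite ltW // tilt_weight_gt0.
pose g (S : dataset X n) (h : hypT X) :=
  (sample_prob R X p n S * tilt_weight R S h)%:E.
have mS S : measurable_fun B (g S).
  apply: measurable_funTS.
  have -> : g S = (fun h => (sample_prob R X p n S)%:E * (tilt_weight R S h)%:E)%E.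
    by apply/funext => h; rewrite -EFinM.
  by apply: emeasurable_funM => //; apply: measurable_tilt_weight.
apply: (@le_trans _ _ (\esum_(S in [set: dataset X n])
    (K%:E * \int[mu]_(h in B) (sample_prob R X p n S * tilt_weight R S h)%:E))%E).
  apply: le_esum => S _.
  have S0 := sample_prob_ge0 S.
  have -> : (\int[mu]_(h in B) (sample_prob R X p n S * tilt_weight R S h)%:E
      = (sample_prob R X p n S)%:E * tilted mu S B)%E.
    under eq_integral do rewrite EFinM.
    rewrite ge0_integralZl //.
    + by apply: measurable_funTS; apply: measurable_tilt_weight.
    + by move=> h _; rewrite lee_fin.
  have [->|Sn0] := eqVneq (sample_prob R X p n S) 0; first by rewrite !mul0e mule0.
  rewrite muleCA lee_wpmul2l ?lee_fin //.
  exact: (exp_mechanism_realizable c0 rep (sample_realizable Sn0) mB).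
(* The sum over samples is a supremum of finite sums, so only finite sums are exchanged with the
   integral. *)
apply: ge_ereal_sup => _ [F [fF _] <-].
rewrite -ge0_mule_fsumr => [|S]; last first.
  by apply: integral_ge0 => h _; rewrite lee_fin mulr_ge0 // sample_prob_ge0.
rewrite -ge0_integral_fsum //; last first.
  by move=> S h _; rewrite lee_fin mulr_ge0 // sample_prob_ge0.
have -> : c^-1 * expR (- eps * n%:R) = K * expR (- (4 * eps / 2) * n%:R).
  by rewrite /K -mulrA -expRD; congr (_ * expR _); field.
rewrite [leRHS]EFinM; apply: lee_wpmul2l; first by rewrite lee_fin.
apply: (@le_trans _ _ (\int[mu]_(h in B) (cst (expR (- (4 * eps / 2) * n%:R))%:E h))%E).
  apply: ge0_le_integral => //.
  - move=> h _; apply: fsume_ge0 => S _.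
    by rewrite lee_fin mulr_ge0 // sample_prob_ge0.
  - by apply: emeasurable_fsum => //; apply: mS.
  - move=> h Bh; apply: le_trans (esum_sample_tilt n Bh _); last by rewrite mulr_ge0.
    by apply: esum_ge; exists F.
rewrite integral_cst // -[leRHS]mule1 lee_wpmul2l ?lee_fin ?expR_ge0 //.
exact: probability_le1.
Qed.

End Accuracy.

Lemma fail_prob_le1 (R : realType) (X : countType) (A : algorithm R X) p n (a : R) :
  is_pmf R X p -> (fail_prob R X A p n a <= 1)%E.
Proof.
move=> pp; rewrite -(esum_sample_prob pp n); apply: le_esum => S _.
rewrite -[leRHS]mule1 lee_wpmul2l ?lee_fin ?sample_prob_ge0 //.
by apply: probability_le1; apply: measurable_loss_gt; have [] := pp.
Qed.

(** [J n] is the largest [j <= n] with [G j n], or 0 if there is none. It lets the accuracy level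
    improve with the sample size. *)
Lemma exists_diagonal (G : nat -> nat -> bool) :
  (forall j, exists N, forall n, (N <= n)%N -> G j n) ->
  exists J : nat -> nat, (forall n, J n = 0%N \/ G (J n) n) /\
  forall j, exists N, forall n, (N <= n)%N -> (j <= J n)%N.
Proof.
move=> hG; exists (fun n => \max_(j < n.+1 | G j n) j); split=> [n|j].
  have [/existsP[j Gj]|no] := boolP [exists j : 'I_n.+1, G j n]; last first.
    left; rewrite big1 // => j Gj; case/negP: no; apply/existsP; by exists j.
  by right; rewrite (bigop.bigmax_eq_arg j) //; case: arg_maxnP.
have [N hN] := hG j; exists (maxn N j) => n; rewrite geq_max => /andP[Nn jn].
by apply: (@leq_bigmax_cond _ (fun i : 'I_n.+1 => G i n) val
  (Ordinal (_ : j < n.+1)%N)); apply: hN.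
Qed.

(** * Noise and upper bounds on fractional cliques *)

Lemma prod_le_factor (R : realFieldType) (T : eqType) (s : seq T) (P : pred T)
    (f : T -> R) z : (forall y, 0 <= f y <= 1) -> z \in s -> P z ->
  \prod_(y <- s | P y) f y <= f z.
Proof.
move=> f01 zs Pz; rewrite (perm_big _ (perm_to_rem zs)) big_cons Pz /=.
have /andP[fz0 _] := f01 z.
rewrite -[leRHS]mulr1 ler_wpM2l //; apply: prodr_ile1 => y _.
exact: f01.
Qed.

Section Noise.
Variables (R : realType) (X : countType) (H : set (X -> bool)) (m : nat).
Variables (q : R) (h : X -> bool).
Hypothesis q01 : 0 <= q <= 1.

(** Probability that [z.1] receives label [z.2] when [h] is flipped there with probability [q]. *)
Definition noise_weight (z : X * bool) : R := if h z.1 != z.2 then q else 1 - q.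

Lemma noise_weight01 z : 0 <= noise_weight z <= 1.
Proof.
by rewrite /noise_weight; case/andP: q01 => *; case: ifP => _; apply/andP; split; lra.
Qed.

Lemma sum_noise_weight x : \sum_b noise_weight (x, b) = 1.
Proof. by rewrite big_bool /noise_weight /=; case: (h x) => /=; lra. Qed.

(** Flips at distinct points are independent. Only an inequality holds, because a repeated example
    counts several times on the left but is a single event. *)
Lemma noise_consistent (L : seq X) (S : dataset X m) : realizable_data X H m S ->
  (forall z, z \in (S : seq _) -> z.1 \in L) ->
  \prod_(z <- S) noise_weight z <=
  \sum_(g : {ffun seq_sub L -> bool} | `[< consistent X m (extend g) S >])
    \prod_t noise_weight (val t, g t).
Proof.
move=> [h0 _ h0S] SL.
(* Labels that conflict with [S] get weight zero, so inconsistent [g] drop out and the sum over [g]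
   factorizes over points. *)
pose F (t : seq_sub L) b : R :=
  if (val t, ~~ b) \in (S : seq _) then 0 else noise_weight (val t, b).
have n01 := noise_weight01.
apply: (@le_trans _ _ (\sum_(g : {ffun seq_sub L -> bool}) \prod_t F t (g t))); last first.
  rewrite [leRHS]big_mkcond; apply: ler_sum => g _; case: asboolP => [gS|ngS].
    rewrite le_eqVlt; apply/orP; left; apply/eqP; apply: eq_bigr => t _.
    rewrite /F; case: ifPn => // /gS /=; rewrite extend_val.
    by case: (g t).
  suff [t ht] : exists t, (val t, ~~ g t) \in (S : seq _).
    by rewrite (bigD1 t) //= /F ht mul0r.
  apply: contrapT => no; apply: ngS => -[x b] xS /=.
  have xL := SL _ xS; rewrite (extend_val g (SeqSub xL)).
  apply/eqP; rewrite -[_ == _]negbK; apply/negP => gb; apply: no; exists (SeqSub xL) => /=.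
  by rewrite (_ : ~~ _ = b) //; move: gb; case: (g _); case: (b).
rewrite -(bigA_distr_bigA F).
have -> : \prod_(z <- S) noise_weight z =
    \prod_(t : seq_sub L) \prod_(z <- S | z.1 == val t) noise_weight z.
  under [RHS]eq_bigr do rewrite big_mkcond.
  rewrite exchange_big /=; apply: eq_big_seq => z /SL zL.
  rewrite (bigD1 (SeqSub zL)) //= eqxx big1 ?mulr1 // => t tz.
  by rewrite ifF //; apply: contraNF tz => /eqP zt; apply/eqP/val_inj.
apply: ler_prod => t _; apply/andP; split.
  by apply: prodr_ge0 => z _; case/andP: (n01 z).
have [/hasP[z zS zt]|/hasPn no] := boolP (has (fun z => z.1 == val t) S); last first.
  rewrite big_seq_cond big1 => [|z /andP[/no /negPf ->]//].
  rewrite -(sum_noise_weight (val t)) ler_sum // => b _; rewrite /F ifF //.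
  by apply/negbTE/negP => /no /=; rewrite eqxx.
apply: le_trans (prod_le_factor _ zS zt) _ => //.
move: zt => /eqP zt; have zE : z = (val t, z.2) by rewrite -zt -surjective_pairing.
rewrite (bigD1 z.2) //= {1}/F ifF; last first.
  apply/negbTE/negP => /h0S /=; rewrite -zt (h0S _ zS).
  by case: (z.2).
rewrite -zE lerDl sumr_ge0 // => b _; rewrite /F; case: ifP => // _.
by case/andP: (n01 (val t, b)).
Qed.

(** The datasets consistent with a fixed labelling form an independent set, of [d]-mass at most 1;
    average this over the noisy versions of [h]. *)
Lemma frac_clique_noise (d : dataset X m -> R) (F : seq (dataset X m)) :
  frac_clique R X H m d -> uniq F -> (forall S, S \in F -> realizable_data X H m S) ->
  \sum_(S <- F) d S * \prod_(z <- S) noise_weight z <= 1.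
Proof.
move=> [d0 dI] uF FR.
pose L := [seq z.1 | z <- flatten (map val F)].
have FL S z : S \in F -> z \in (S : seq _) -> z.1 \in L.
  move=> SF zS; apply: map_f; apply/flattenP; exists (val S) => //.
  exact: map_f.
have n01 := noise_weight01.
apply: (@le_trans _ _ (\sum_(S <- F) \sum_(g : {ffun seq_sub L -> bool}
    | `[< consistent X m (extend g) S >]) d S * \prod_t noise_weight (val t, g t))).
  rewrite big_seq [leRHS]big_seq; apply: ler_sum => S SF; rewrite -mulr_sumr.
  rewrite ler_wpM2l // ?d0 //; first exact: FR.
  by apply: noise_consistent; [exact: FR|move=> z; apply: FL].
under eq_bigr do rewrite big_mkcond.
rewrite exchange_big /=.
have one : \sum_(g : {ffun seq_sub L -> bool}) \prod_t noise_weight (val t, g t) = 1.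
  rewrite -(bigA_distr_bigA (fun (t : seq_sub L) b => noise_weight (val t, b))) big1 //.
  by move=> t _; apply: sum_noise_weight.
rewrite -[leRHS]one; apply: ler_sum => g _.
set w := \prod_t _.
have w0 : 0 <= w by apply: prodr_ge0 => t _; case/andP: (n01 (val t, g t)).
rewrite -big_mkcond -mulr_suml -[leRHS]mul1r ler_wpM2r //.
rewrite -lee_fin -sumEFin -big_filter.
pose I := [set S | Gvert X H m S /\ consistent X m (extend g) S].
apply: le_trans (dI I _).
  set s := [seq i <- F | _]; apply: esum_ge.
  exists [set` s]; last by rewrite -fsbig_seq // filter_uniq.
  split; first exact: finite_seq.
  by move=> S /=; rewrite mem_filter => /andP[/asboolP cS /FR rS].
split=> [S []//|S S' [_ cS] [_ cS']].
by case=> -[x [/= x0 x1]];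
  [have := cS _ x0; have := cS' _ x1 | have := cS' _ x0; have := cS _ x1] => /= ->.
Qed.

End Noise.

Lemma frac_clique_number_le (R : realType) (X : countType) (H : set (X -> bool)) m (B : R) :
  (forall d F, frac_clique R X H m d -> uniq F ->
     (forall S, S \in F -> realizable_data X H m S) -> \sum_(S <- F) d S <= B) ->
  (frac_clique_number R X H m <= B%:E)%E.
Proof.
move=> hB; apply: ge_ereal_sup => _ [d dc <-].
apply: ge_ereal_sup => _ [A [/finite_seqP[s ->] sV] <-].
rewrite (_ : [set` s] = [set` undup s]); last first.
  by apply/seteqP; split => S /=; rewrite mem_undup.
rewrite -fsbig_seq ?undup_uniq // sumEFin lee_fin; apply: hB => //.
  exact: undup_uniq.
by move=> S; rewrite mem_undup; apply: sV.
Qed.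

(** With [q = 1 / 2] the labelling is uniform and every noise product equals [2 ^- m]. *)
Lemma frac_clique_number_le_exp (R : realType) (X : countType) (H : set (X -> bool)) m :
  (frac_clique_number R X H m <= (2 ^ m)%:R%:E)%E.
Proof.
apply: frac_clique_number_le => d F dc uF FR.
have q01 : 0 <= (1 / 2 : R) <= 1 by apply/andP; split; lra.
have := frac_clique_noise (fun=> true) q01 dc uF FR.
have E (S : dataset X m) :
    \prod_(z <- S) noise_weight (1 / 2) (fun=> true) z = (2 ^+ m)^-1 :> R.
  rewrite big_tuple -exprVn -[in RHS](card_ord m) -prodr_const.
  by apply: eq_bigr => i _; rewrite /noise_weight; case: ifP => _; lra.
under eq_bigr do rewrite E.
by rewrite -mulr_suml ler_pdivrMr ?exprn_gt0 // mul1r natrX.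
Qed.

(** * The two implications *)

Lemma cvg_inv_diverging (R : realType) (J : nat -> nat) (a : R) : 0 <= a ->
  (forall j, exists N, forall n, (N <= n)%N -> (j <= J n)%N) ->
  a / (J n).+1%:R @[n --> \oo] --> (0 : R).
Proof.
move=> a0 hJ; apply/cvgrPdist_lt => e e0.
have [N hN] := hJ (Num.bound (a / e)).
exists N => // n /= Nn; rewrite sub0r normrN ger0_norm ?divr_ge0 //.
rewrite ltr_pdivrMr ?ltr0n // mulrC -ltr_pdivrMr //.
apply: lt_le_trans (archi_boundP _) _; first by rewrite divr_ge0 // ltW.
by rewrite ler_nat leqW // hN.
Qed.

Lemma CDstar_finite_learnable (R : realType) (X : countType) (H : set (X -> bool)) :
  CDstar_finite R X H -> pure_dp_pac_learnable R X H.
Proof.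
move=> [N hN].
have lt2 : (frac_clique_number R X H N.+1 < (2 ^ N.+1)%:R%:E)%E.
  rewrite lt_neqAle frac_clique_number_le_exp andbT; apply/eqP => E.
  by have := hN _ E; rewrite ltnn.
pose e j : R := j.+1%:R^-1.
have e0 j : 0 < e j by rewrite invr_gt0 ltr0n.
have hrep j : exists x : R * probability (hypT X) R,
    0 < x.1 /\ represents H x.2 (e j) x.1.
  by have [c c0 [mu rep]] := exists_representation (ltn0Sn N) lt2 (e0 j); exists (c, mu).
have [x hx] := choice hrep.
pose c j := (x j).1; pose mu j := (x j).2.
have c0 j : 0 < c j by have [] := hx j.
have rep j : represents H (mu j) (e j) (c j) by have [] := hx j.
(* At sample size [n], level [j] already has failure probability at most [e j]. *)
pose G j n := (c j)^-1 * expR (- e j * n%:R) <= e j.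
have [J [J0 Jinf]] : exists J : nat -> nat, (forall n, J n = 0%N \/ G (J n) n) /\
    forall j, exists N, forall n, (N <= n)%N -> (j <= J n)%N.
  apply: exists_diagonal => j.
  have ee1 : expR (- e j) < 1 by rewrite -[ltRHS]expR0 ltr_expR oppr_lt0.
  have [k k0 hk] := exists_expr_gap ((c j)^-1 / e j) (expR_gt0 (- e j)) ee1.
  exists k => n kn; rewrite /G -[leRHS]mul1r -ler_pdivrMr // mulrAC.
  move: hk; rewrite expr1n -expRM_natr => /ltW; apply: le_trans.
  rewrite ler_wpM2l ?divr_ge0 ?invr_ge0 ?(ltW (c0 j)) ?(ltW (e0 j)) //.
  by rewrite ler_expR !mulNr lerN2 ler_wpM2l ?(ltW (e0 j)) // ler_nat.
(* The factor 2 in [beta] makes the failure bound strict, and when [J m = 0] it puts [beta] above 1,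
   where the trivial bound suffices. *)
exists (fun m S => exp_mechanism (mu (J m)) S), (fun m => 4 / (J m).+1%:R),
  (fun m => 2 / (J m).+1%:R), 2; split => //.
- exact: cvg_inv_diverging.
- exact: cvg_inv_diverging.
- move=> m p pp pr.
  have [Jm|Gm] := J0 m.
    apply: le_lt_trans (fail_prob_le1 _ _ _ pp) _.
    by rewrite Jm lte_fin; lra.
  have := fail_prob_exp_mechanism pp pr (c0 (J m)) (ltW (e0 (J m))) (rep (J m)) m.
  move=> /le_lt_trans; apply; rewrite lte_fin; apply: le_lt_trans Gm _.
  by rewrite /e -[ltLHS]mul1r ltr_pM2r ?e0 // ltr1n.
- by move=> m S S' nb E mE; apply: exp_mechanism_dp.
Qed.

(** Hybrid argument: replace the examples one at a time, paying a factor [expR eps] for each. *)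
Lemma group_privacy (R : realType) (X : countType) (A : algorithm R X) (eps : R) m
    (S S' : dataset X m) (E : set (hypT X)) :
  pure_dp R X A eps m -> measurable E ->
  (A m S E <= (expR (eps * m%:R))%:E * A m S' E)%E.
Proof.
move=> dp mE.
suff claim k (T T' : dataset X m) : (k <= m)%N ->
    (forall j : 'I_m, (k <= j)%N -> tnth T j = tnth T' j) ->
    (A m T E <= (expR (eps * k%:R))%:E * A m T' E)%E.
  by apply: claim => // j; rewrite leqNgt ltn_ord.
elim: k T T' => [|k IH] T T' km hT.
  have -> : T = T' by apply: eq_from_tnth => j; apply: hT.
  by rewrite mulr0 expR0 mul1e.
pose U : dataset X m := [tuple if val j == k then tnth T' j else tnth T j | j < m].
have UT' (j : 'I_m) : (k <= j)%N -> tnth U j = tnth T' j.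
  rewrite tnth_mktuple leq_eqVlt eq_sym; case: eqP => //= _ kj.
  exact: hT.
have h := IH U T' (ltnW km) UT'.
have nb : neighbors X m T U.
  exists (Ordinal km) => j jk; rewrite tnth_mktuple ifF //.
  by apply: contraNF jk => /eqP jk; apply/eqP/val_inj.
apply: le_trans (dp _ _ nb _ mE) _.
apply: le_trans (lee_wpmul2l _ h) _; first by rewrite lee_fin expR_ge0.
by rewrite muleA -EFinM -expRD -natr1 mulrDr mulr1 addrC.
Qed.

Section Empirical.
Variables (R : realType) (X : countType) (n : nat) (S : dataset X n).
Hypothesis n0 : (0 < n)%N.

Definition empirical (z : X * bool) : R :=
  \sum_(y <- S) if y == z then n%:R^-1 else 0.

Lemma empirical_ge0 z : 0 <= empirical z.
Proof. by apply: sumr_ge0 => y _; case: ifP; rewrite ?invr_ge0. Qed.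

Lemma esum_empirical (I : set (X * bool)) :
  (\esum_(z in I) (empirical z)%:E = ((count (mem I) S)%:R / n%:R)%:E)%E.
Proof.
under eq_esum do rewrite -sumEFin.
rewrite esum_sum; last by move=> z y _ _; case: ifP; rewrite lee_fin ?invr_ge0.
rewrite -sum1_count natr_sum mulr_suml -sumEFin [RHS]big_mkcond /=.
apply: eq_bigr => y _; under eq_esum do rewrite (fun_if EFin).
by rewrite esum_point ?lee_fin ?invr_ge0 // mul1r.
Qed.

Lemma empirical_pmf : is_pmf R X empirical.
Proof.
split; first exact: empirical_ge0.
rewrite esum_empirical (eq_count (a2 := predT)) => [|z]; last by rewrite /= in_setT.
by rewrite count_predT size_tuple divff // pnatr_eq0 -lt0n.
Qed.

Lemma loss_empirical h : loss R X empirical h = ((err h S)%:R / n%:R)%:E.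
Proof.
rewrite /loss esum_empirical; congr (_%:R / _)%:E; apply: eq_count => z /=.
by apply/idP/idP; rewrite inE.
Qed.

Lemma empirical_realizable H : realizable_data X H n S -> realizable_dist R X H empirical.
Proof.
move=> [h Hh hS]; apply/le_anti/andP; split.
  apply: ereal_inf_le; exists (loss R X empirical h); first by exists h.
  rewrite loss_empirical /err (eq_in_count (a2 := pred0)) ?count_pred0 ?mul0r //.
  by move=> z /hS ->; rewrite eqxx.
apply: le_ereal_inf_tmp => _ [g _ <-]; apply: esum_ge0 => z _.
by rewrite lee_fin empirical_ge0.
Qed.

End Empirical.

(** Learning the empirical distribution of [S] succeeds with probability at least one half on some
    sample [S'] of size [m]; group privacy carries this over to [S0], which is chosen independently
    of [S]. *)
Lemma learner_low_error (R : realType) (X : countType) (H : set (X -> bool))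
    (A : algorithm R X) m (alpha beta eps : R) n (S0 : dataset X m) (S : dataset X n) :
  learner R X H A m alpha beta -> pure_dp R X A eps m -> beta <= 1 / 2 ->
  (0 < n)%N -> realizable_data X H n S ->
  ((expR (- (eps * m%:R)) / 2)%:E <= A m S0 (low_error alpha S))%E.
Proof.
move=> lrn dp b2 n0 rS.
have pp := @empirical_pmf R X n S n0; set p := @empirical R X n S in pp.
have p0 : forall z, 0 <= p z by have [] := pp.
have := lrn p pp (empirical_realizable R rS).
set B := fun h : hypT X => (alpha%:E < loss R X p h)%E.
have mB : measurable [set h | B h] by apply: measurable_loss_gt.
have mlow := measurable_low_error alpha S.
have BC : low_error alpha S = ~` [set h | B h].
  apply/seteqP; split => h; rewrite /B /low_error /= loss_empirical // lte_fin;
    rewrite ltr_pdivlMr ?ltr0n //.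
    by move=> hl; apply/negP; rewrite -leNgt.
  by move/negP; rewrite -leNgt.
move=> hf.
have [S' hS'] : exists S', (A m S' [set h | B h] < (1 / 2)%:E)%E.
  apply: contrapT => no; move: hf; rewrite ltNge => /negP; apply.
  apply: (@le_trans _ _ (1 / 2)%:E); first by rewrite lee_fin.
  rewrite -[leLHS]mule1 -(esum_sample_prob pp m) -esumZl //; last first.
    by move=> T; rewrite lee_fin sample_prob_ge0.
  apply: le_esum => T _; rewrite muleC lee_wpmul2l ?lee_fin ?sample_prob_ge0 //.
  by rewrite leNgt; apply/negP => hT; apply: no; exists T.
have h2 : ((1 / 2)%:E <= A m S' (low_error alpha S))%E.
  rewrite BC probability_setC // leeBrDr ?fin_num_measure //.
  have : ((1 / 2)%:E + A m S' [set h | B h] <= (1 / 2)%:E + (1 / 2)%:E)%E.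
    by rewrite leeD2l // ltW.
  by move/le_trans; apply; rewrite -EFinD lee_fin; lra.
have h3 := le_trans h2 (group_privacy S' S0 dp mlow).
move: h3; rewrite -(fineK (fin_num_measure (A m S0) _ mlow)) -EFinM !lee_fin => h3.
have e0 := expR_gt0 (eps * m%:R).
by rewrite expRN mulrC ler_pdivrMr // mulrC; lra.
Qed.

Lemma noise_weight_low_error (R : realType) (X : countType) n (S : dataset X n)
    (h : X -> bool) :
  low_error (1 / 8 : R) S h ->
  2 ^- n * (3 / 2) ^+ (n %/ 2) <= \prod_(z <- S) noise_weight (1 / 4 : R) h z.
Proof.
move=> hl; set e := err h S.
have he : (8 * e <= n)%N.
  by rewrite -(ler_nat R) natrM; move: hl; rewrite /low_error /= -/e; lra.
have -> : \prod_(z <- S) noise_weight (1 / 4 : R) h z = (1 / 4) ^+ e * (3 / 4) ^+ (n - e).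
  rewrite -[X in (X - _)%N](size_tuple S) /e /err; elim: (val S) => [|z s IH] /=.
    by rewrite big_nil mulr1.
  rewrite big_cons IH /noise_weight; set k := count _ _.
  have ks : (k <= size s)%N by apply: count_size.
  case: (h z.1 != z.2) => /=.
    by rewrite add1n subSS exprS mulrA.
  rewrite add0n subSn // exprS mulrCA; congr (_ * (_ * _)); lra.
have E1 : (3 / 4) ^+ n <= (3 / 4) ^+ (n - e) :> R.
  by apply: ler_wiXn2l; rewrite ?leq_subr //; lra.
apply: le_trans (ler_wpM2l _ E1); last by rewrite exprn_ge0 //; lra.
have -> : (3 / 4) ^+ n = 2 ^- n * (3 / 2) ^+ n :> R.
  by rewrite -exprVn -exprMn; congr (_ ^+ _); lra.
rewrite mulrCA ler_wpM2l ?invr_ge0 ?exprn_ge0 //.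
(* Since [8 * e <= n], half of the exponent can be spent on the errors: [(3 / 2) ^+ 4 >= 4] pays for
   each factor [1 / 4]. *)
have E2 : (3 / 2) ^+ (4 * e + n %/ 2) <= (3 / 2) ^+ n :> R.
  by apply: ler_weXn2l; [lra|lia].
apply: le_trans (ler_wpM2l _ E2); last by rewrite exprn_ge0 //; lra.
have t0 : 0 <= 3 / 2 :> R by lra.
rewrite exprD mulrA ler_peMl ?exprn_ge0 //.
rewrite exprM -exprMn exprn_ege1 //.
by rewrite !exprS expr0; lra.
Qed.

(** Integrates the noise bound over [h] drawn from [mu], keeping only the low-error hypotheses for
    each dataset. *)
Lemma frac_clique_sum_le (R : realType) (X : countType) (H : set (X -> bool)) n
    (mu : probability (hypT X) R) (c : R) d (F : seq (dataset X n)) :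
  (forall S, realizable_data X H n S -> (c%:E <= mu (low_error (1 / 8 : R) S))%E) ->
  frac_clique R X H n d -> uniq F -> (forall S, S \in F -> realizable_data X H n S) ->
  (\sum_(S <- F) d S) * (2 ^- n * (3 / 2) ^+ (n %/ 2)) * c <= 1.
Proof.
move=> hmu dc uF FR; set th := _ * _ ^+ _.
have th0 : 0 <= th by rewrite mulr_ge0 ?invr_ge0 ?exprn_ge0 //; lra.
have q01 : 0 <= (1 / 4 : R) <= 1 by apply/andP; split; lra.
(* The absolute value keeps [f] nonnegative outside the vertex set, where [d] is unconstrained. *)
pose f (S : dataset X n) (h : hypT X) : \bar R :=
  ((`|d S| * th)%:E * (\1_(low_error (1 / 8 : R) S) h)%:E)%E.
have mf S : measurable_fun setT (f S).
  apply: emeasurable_funM => //; apply: measurableT_comp => //.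
  by apply: measurable_indic; apply: measurable_low_error.
have f0 S h : (0 <= f S h)%E.
  by rewrite mule_ge0 // lee_fin ?mulr_ge0.
have int_f S : (\int[mu]_h f S h = (`|d S| * th)%:E * mu (low_error (1 / 8 : R) S))%E.
  rewrite ge0_integralZl_EFin ?mulr_ge0 //.
    by rewrite integral_indic ?setIT //; apply: measurable_low_error.
  by apply: measurableT_comp => //; apply: measurable_indic; apply: measurable_low_error.
have : (\int[mu]_h \sum_(S <- F) f S h <= 1)%E.
  apply: (@le_trans _ _ (\int[mu]_h (cst 1 h))%E); last first.
    by rewrite integral_cst // mul1e; apply: probability_le1.
  apply: ge0_le_integral => //.
  - by move=> h _; apply: sume_ge0.
  - exact: emeasurable_sum.
  move=> h _; rewrite sumEFin lee_fin.
  apply: le_trans (frac_clique_noise h q01 dc uF FR).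
  rewrite big_seq [leRHS]big_seq; apply: ler_sum => S SF.
  have dS : 0 <= d S by have [d0 _] := dc; apply/d0/FR.
  rewrite ger0_norm // -mulrA ler_wpM2l // indicE.
  have [hl|nl] := pselect (low_error (1 / 8 : R) S h).
    by rewrite mem_set // mulr1; apply: noise_weight_low_error.
  rewrite memNset // mulr0; apply: prodr_ge0 => z _.
  by case/andP: (noise_weight01 h q01 z).
rewrite ge0_integral_sum //; under eq_bigr do rewrite int_f.
move=> h1; rewrite -lee_fin; apply: le_trans h1.
rewrite -mulrA mulr_suml -sumEFin big_seq [leRHS]big_seq; apply: lee_sum => S SF.
have dS : 0 <= d S by have [d0 _] := dc; apply/d0/FR.
rewrite ger0_norm // mulrA EFinM lee_wpmul2l ?lee_fin ?mulr_ge0 //.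
exact/hmu/FR.
Qed.

Lemma learnable_CDstar_finite (R : realType) (X : countType) (H : set (X -> bool)) :
  pure_dp_pac_learnable R X H -> CDstar_finite R X H.
Proof.
move=> [A [alpha [beta [eps [_ ca cb lrn dp]]]]].
(* The fixed input dataset needs a point. On an empty domain there is no dataset of positive size,
   so the clique number is at most 0 there. *)
have [[x0 _]|noX] := pselect (exists x : X, True); last first.
  exists 0%N => n; case: n => // n E.
  have : (frac_clique_number R X H n.+1 <= 0%:E)%E.
    apply: frac_clique_number_le => d [|S F] _ _ _; first by rewrite big_nil.
    by case: noX; exists (thead S).1.
  by rewrite E lee_fin lern0 expn_eq0.
(* One sample size is fixed once and for all, so that [c] below does not depend on [n]. *)
have [m [am bm]] : exists m, alpha m <= 1 / 8 /\ beta m <= 1 / 2.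
  have [m] : exists m, alpha m < 1 / 8 /\ beta m < 1 / 2.
    apply: (@filter_ex _ \oo); apply: filterI.
      by apply: (cvgr_lt _ ca); lra.
    by apply: (cvgr_lt _ cb); lra.
  by move=> [/ltW ? /ltW ?]; exists m.
pose mu := A m [tuple (x0, true) | i < m].
pose c := expR (- (eps * m%:R)) / 2.
have c0 : 0 < c by rewrite divr_gt0 // expR_gt0.
(* For [n > 2 * k] the gain [(3 / 2) ^+ (n %/ 2)] exceeds [c^-1], which pushes the clique number
   below [2 ^ n]. *)
have [k _ hk] := @exists_expr_gap R (3 / 2) 1 c^-1 ltr01 ltac:(lra).
rewrite expr1n mulr1 in hk.
exists (2 * k)%N => n E; rewrite leqNgt; apply/negP => kn.
have hmu (S : dataset X n) : realizable_data X H n S ->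
    (c%:E <= mu (low_error (1 / 8 : R) S))%E.
  move=> rS.
  have n0 : (0 < n)%N by lia.
  apply: le_trans (learner_low_error _ (lrn m) (dp m) bm n0 rS) _.
  apply: le_measure; rewrite ?inE; try exact: measurable_low_error.
  by move=> h; rewrite /low_error /= => /le_trans; apply; rewrite ler_wpM2r.
set b := 2 ^- n * (3 / 2) ^+ (n %/ 2) : R.
have b0 : 0 < b by rewrite mulr_gt0 ?invr_gt0 ?exprn_gt0 //; lra.
have : (frac_clique_number R X H n <= (c * b)^-1%:E)%E.
  apply: frac_clique_number_le => d F dc uF FR.
  have := frac_clique_sum_le hmu dc uF FR; rewrite -/b -mulrA (mulrC b).
  by move=> h; rewrite -[leRHS]mul1r ler_pdivlMr // mulr_gt0.
have p2 : 0 < 2 ^+ n :> R by rewrite exprn_gt0.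
have cb0 : 0 < c * b by rewrite mulr_gt0.
have -> : (c * b)^-1 = 2 ^+ n * (c * (3 / 2) ^+ (n %/ 2))^-1.
  by rewrite /b mulrCA invfM invrK.
rewrite E lee_fin natrX ler_pMr // invf_ge1; last first.
  by rewrite mulr_gt0 // exprn_gt0 //; lra.
apply/negP; rewrite -ltNge -ltr_pdivrMl // mulr1; apply: lt_le_trans hk _.
by apply: ler_weXn2l; [lra|lia].
Qed.

Theorem mainTheorem4 (R : realType) (X : countType) (H : set (X -> bool)) :
  pure_dp_pac_learnable R X H <-> CDstar_finite R X H.
Proof. by split; [exact: learnable_CDstar_finite|exact: CDstar_finite_learnable]. Qed.
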